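(* Let $\lambda\ge1$. Then $\mathcal{B}_H(\lambda)\subset h^p$ for every $p$ with $0<p<\frac{1}{\lambda^2-1}$, where $\frac1{\lambda^2-1}$ is interpreted as $\infty$ when $\lambda=1$.
   Context: $\mathbb{D}$ is the open unit disk. $\mathcal{H}$ is the class of harmonic mappings $f=h+\overline g$ in $\mathbb{D}$ ($h,g$ analytic) with $h(0)=g(0)=h'(0)-1=0$. $\|T_f\|=\sup_{z\in\mathbb{D},\ \theta\in[0,2\pi]}(1-|z|^2)\left|\frac{h''(z)+e^{i\theta}g''(z)}{h'(z)+e^{i\theta}g'(z)}\right|$, with $\|T_f\|=\infty$ if $h'+e^{i\theta}g'$ has a zero in $\mathbb{D}$ for some $\theta$; and $\mathcal{B}_H(\lambda)=\{f\in\mathcal{H}:\|T_f\|\le 2\lambda\}$. For $0<p<\infty$, $h^p$ is the set of harmonic mappings $f$ in $\mathbb{D}$ for which $M_p(r,f)=\left\{\frac1{2\pi}\int_0^{2\pi}|f(re^{i\theta})|^p\,d\theta\right\}^{1/p}$ is bounded on $0<r<1$. *)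

(* Defs.v *)
From Stdlib Require Import Reals ClassicalEpsilon.
From Coquelicot Require Import Coquelicot.
Open Scope R_scope.

Definition disk (z : C) : Prop := Cmod z < 1.

Definition cis (theta : R) : C := (cos theta, sin theta).

(* Functions on the disk are total functions [C -> C]; only their values on
   [disk] matter.  The derivative is the complex one. *)
Definition analytic (h : C -> C) : Prop :=
  forall z : C, disk z -> @ex_derive C_AbsRing C_NormedModule h z.

Definition harmonic_decomposition (f h g : C -> C) : Prop :=
  analytic h /\ analytic g /\
  forall z : C, disk z -> f z = (h z + Cconj (g z))%C.

Definition harmonic_mapping (f : C -> C) : Prop :=
  exists h g : C -> C, harmonic_decomposition f h g.

(* [f] is in the class H, with [h] and [g] the analytic and co-analytic parts
   of [f].  The condition [g 0 = 0] makes them unique on the disk. *)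
Definition class_H (f h g : C -> C) : Prop :=
  harmonic_decomposition f h g /\
  h 0%C = 0%C /\ g 0%C = 0%C /\ (C_derive h 0 - 1 = 0)%C.

Definition rotated_derivative (h g : C -> C) (theta : R) (z : C) : C :=
  (C_derive h z + cis theta * C_derive g z)%C.

Definition rotated_derivative2 (h g : C -> C) (theta : R) (z : C) : C :=
  (C_derive (C_derive h) z + cis theta * C_derive (C_derive g) z)%C.

Definition T_norm (h g : C -> C) : Rbar :=
  if excluded_middle_informative
       (exists (z : C) (theta : R),
          disk z /\ 0 <= theta <= 2 * PI /\
          rotated_derivative h g theta z = 0%C)
  then p_infty
  else Lub_Rbar (fun x : R =>
         exists (z : C) (theta : R),
           disk z /\ 0 <= theta <= 2 * PI /\
           x = (1 - Cmod z ^ 2) *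
               Cmod (rotated_derivative2 h g theta z /
                     rotated_derivative h g theta z)%C).

Definition B_H (lambda : R) (f : C -> C) : Prop :=
  exists h g : C -> C,
    class_H f h g /\ Rbar_le (T_norm h g) (Finite (2 * lambda)).

(* [x ^ p] for [0 <= x] and [0 < p]; the library's [Rpower 0 p] is 1, not 0. *)
Definition rpow (x p : R) : R :=
  if Rlt_dec 0 x then Rpower x p else 0.

Definition M_mean (p r : R) (f : C -> C) : R :=
  rpow (/ (2 * PI) *
        RInt (fun theta : R => rpow (Cmod (f (RtoC r * cis theta)%C)) p)
             0 (2 * PI))
       (/ p).

Definition h_space (p : R) (f : C -> C) : Prop :=
  harmonic_mapping f /\
  exists M : R, forall r : R, 0 < r < 1 -> M_mean p r f <= M.

(* 1 / (lambda^2 - 1), read as infinity when lambda = 1. *)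
Definition hardy_exponent (lambda : R) : Rbar :=
  if Req_EM_T lambda 1 then p_infty else Finite (1 / (lambda ^ 2 - 1)).

(* Main.v *)
Require Import Defs.
From Stdlib Require Import Reals Lra.
From Coquelicot Require Import Coquelicot.
Open Scope R_scope.

(** The functions [h + g] and [h - g] are two of the rotations [h + e^{i theta} g]
    bounded by the norm of [T_f], and [|f| <= |h + g| + |h - g|].  So it is enough to bound
    the means of [|F|^p] for an analytic [F] whose derivative [phi] has no zero and satisfies
    [(1 - |z|^2) |phi' / phi| <= 2 lambda] ([hardy_of_preschwarzian]).

    In logarithmic polar coordinates [z = e^{s + it}] with [s < 0], put [u = |phi|^p] and
    [Q = z phi' / phi].  Then [u_s = p u Re Q] and [u_t = - p u Im Q], whence
    [u_ss + u_tt = p^2 u |Q|^2], while the hypothesis gives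
    [|Q| <= lambda / sinh (-s) <= lambda / (-s)].  Integration over [t] removes [u_tt] by
    periodicity, and the mean [I] of [u] obeys [I'' <= (p lambda)^2 s^-2 I].  The function
    [(-s)^-a] solves this as an equation when [a (a + 1) = (p lambda)^2], and a Wronskian
    comparison gives [I = O((-s)^-a)] as [s] tends to 0 ([mean_growth]).

    The condition [p (lambda^2 - 1) < 1] says exactly that [a < p].  It leaves room for an
    exponent [c] between [a] and [p].  As [|u_s| <= p lambda u / (-s)], the
    function [(-s)^c u] stays below [E = u(-1) + p lambda * int (-s)^(c-1) u ds]
    ([modpow_le_majorant]), and [E] has a bounded mean because [c > a]
    ([majorant_mean_bounded]).  On a radius [|phi| <= E^(1/p) (-s)^(-c/p)], which is integrable
    because [c < p]; hence [|F|] is at most a constant plus a multiple of [E^(1/p)]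
    ([radial_growth]).  This maximal function treats [p < 1] and [p >= 1] alike.

    All this differentiates [F] three times, whereas analyticity only provides one
    derivative at each point of the disk.  The regularity comes from Goursat's theorem
    ([closed_form_boundary_integral]): Cauchy's formula follows from it by deforming a
    circle ([cauchy_formula]); differentiation of the Cauchy kernel shows that the
    derivative of an analytic function is analytic ([analytic_C_derive]). *)

(** * Derivatives of complex functions and of plane curves *)

(** The increment form makes derivatives comparable across the various normed-module
    structures carried by [C]: they differ in their uniform structure but share the norm. *)
Lemma is_derive_eps {K : AbsRing} {V : NormedModule K} (f : K -> V) (x : K) (l : V) :
  is_derive f x l <->
  forall eps : R, 0 < eps -> exists delta : R, 0 < delta /\
    forall y : K, abs (minus y x) < delta ->
      norm (minus (minus (f y) (f x)) (scal (minus y x) l))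
        <= eps * abs (minus y x).
Proof.
split.
- intros [_ H] eps Heps.
  destruct (H x (fun P HP => HP) (mkposreal eps Heps)) as [d Hd].
  exists d; split; [apply cond_pos|].
  intros y Hy; exact (Hd y Hy).
- intros H; split; [apply is_linear_scal_l|].
  intros x0 Hx0.
  assert (E := is_filter_lim_locally_unique _ _ Hx0).
  rewrite <- E.
  intros eps.
  destruct (H eps (cond_pos eps)) as [d [Hd0 Hd]].
  exists (mkposreal d Hd0); intros y Hy; exact (Hd y Hy).
Qed.

Notation is_Cderive := (@is_derive C_AbsRing C_NormedModule).
Notation is_velocity := (@is_derive R_AbsRing C_R_NormedModule).

Lemma is_Cderive_eps (f : C -> C) (z l : C) :
  is_Cderive f z l <->
  forall eps : R, 0 < eps -> exists delta : R, 0 < delta /\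
    forall w : C, Cmod (w - z) < delta ->
      Cmod (f w - f z - (w - z) * l) <= eps * Cmod (w - z).
Proof. exact (is_derive_eps f z l). Qed.

Lemma is_velocity_eps (c : R -> C) (t : R) (l : C) :
  is_velocity c t l <->
  forall eps : R, 0 < eps -> exists delta : R, 0 < delta /\
    forall u : R, Rabs (u - t) < delta ->
      Cmod (c u - c t - RtoC (u - t) * l) <= eps * Rabs (u - t).
Proof.
split.
- intros H eps Heps.
  destruct (proj1 (is_derive_eps (V := C_R_NormedModule) c t l) H eps Heps)
    as [d [Hd0 Hd]].
  exists d; split; [exact Hd0|]; intros u Hu.
  specialize (Hd u Hu).
  rewrite <- Cmod_norm in Hd.
  replace (c u - c t - RtoC (u - t) * l)%C with
     (minus (minus (c u) (c t)) (@scal _ C_R_NormedModule (minus u t) l));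
   [exact Hd|].
  apply injective_projections; simpl; unfold minus, plus, opp, scal, mult; simpl;
    unfold mult; simpl; ring.
- intros H; apply (is_derive_eps (V := C_R_NormedModule)); intros eps Heps.
  destruct (H eps Heps) as [d [Hd0 Hd]].
  exists d; split; [exact Hd0|]; intros u Hu.
  specialize (Hd u Hu).
  rewrite <- Cmod_norm.
  match goal with |- Cmod ?x <= _ =>
    replace x with (c u - c t - RtoC (u - t) * l)%C; [exact Hd|] end.
  apply injective_projections; simpl; unfold minus, plus, opp, scal, mult; simpl;
    unfold mult; simpl; ring.
Qed.

Lemma is_Rderive_eps (f : R -> R) (x l : R) :
  is_derive f x l <->
  forall eps : R, 0 < eps -> exists delta : R, 0 < delta /\
    forall y : R, Rabs (y - x) < delta ->
      Rabs (f y - f x - (y - x) * l) <= eps * Rabs (y - x).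
Proof. exact (is_derive_eps f x l). Qed.

Lemma im_le_Cmod (z : C) : Rabs (Im z) <= Cmod z.
Proof. exact (Rle_trans _ _ _ (Rmax_r _ _) (Rmax_Cmod z)). Qed.

Lemma Cmod_sub_comm (z w : C) : Cmod (z - w) = Cmod (w - z).
Proof. rewrite <- Cmod_opp; f_equal; ring. Qed.

Lemma Cmod_le_sum (z : C) : Cmod z <= Rabs (Re z) + Rabs (Im z).
Proof.
rewrite <- (Rabs_pos_eq (Cmod z)) by apply Cmod_ge_0.
rewrite <- (Rabs_pos_eq (_ + _)) by (apply Rplus_le_le_0_compat; apply Rabs_pos).
apply Rsqr_le_abs_0; unfold Rsqr.
assert (H := Cmod2_alt z); simpl in H.
assert (H1 := Rsqr_abs (Re z)). assert (H2 := Rsqr_abs (Im z)). unfold Rsqr in H1, H2.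
assert (H3 := Rmult_le_pos _ _ (Rabs_pos (Re z)) (Rabs_pos (Im z))).
nra.
Qed.

Lemma is_velocity_components (c : R -> C) (t : R) (l : C) :
  is_velocity c t l <->
  is_derive (fun u => Re (c u)) t (Re l) /\
  is_derive (fun u => Im (c u)) t (Im l).
Proof.
rewrite is_velocity_eps, !is_Rderive_eps.
split.
- intros H; split; intros eps Heps; destruct (H eps Heps) as [d [Hd0 Hd]];
    exists d; (split; [exact Hd0|]); intros u Hu; specialize (Hd u Hu);
    refine (Rle_trans _ _ _ _ Hd).
  + refine (Rle_trans _ _ _ _ (re_le_Cmod _)); right; unfold Re, Im; simpl; f_equal; ring.
  + refine (Rle_trans _ _ _ _ (im_le_Cmod _)); right; unfold Re, Im; simpl; f_equal; ring.
- intros [H1 H2] eps Heps.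
  destruct (H1 (eps / 2)) as [d1 [Hd1 K1]]; [lra|].
  destruct (H2 (eps / 2)) as [d2 [Hd2 K2]]; [lra|].
  exists (Rmin d1 d2); split; [now apply Rmin_pos|].
  intros u Hu.
  specialize (K1 u (Rlt_le_trans _ _ _ Hu (Rmin_l _ _))).
  specialize (K2 u (Rlt_le_trans _ _ _ Hu (Rmin_r _ _))).
  refine (Rle_trans _ _ _ (Cmod_le_sum _) _).
  replace (Re (c u - c t - RtoC (u - t) * l)%C) with
    (Re (c u) - Re (c t) - (u - t) * Re l) by (unfold Re, Im; simpl; ring).
  replace (Im (c u - c t - RtoC (u - t) * l)%C) with
    (Im (c u) - Im (c t) - (u - t) * Im l) by (unfold Re, Im; simpl; ring).
  lra.
Qed.

Lemma is_velocity_comp (f : C -> C) (c : R -> C) (t : R) (l v : C) :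
  is_Cderive f (c t) l -> is_velocity c t v ->
  is_velocity (fun u => f (c u)) t (l * v)%C.
Proof.
rewrite is_Cderive_eps, !is_velocity_eps.
intros Hf Hc eps Heps.
set (m := Cmod v + 1). set (k := Cmod l + 1).
assert (Hm : 0 < m) by (generalize (Cmod_ge_0 v); unfold m; lra).
assert (Hk : 0 < k) by (generalize (Cmod_ge_0 l); unfold k; lra).
destruct (Hf (eps / (2 * m))) as [d1 [Hd1 K1]].
{ apply Rdiv_lt_0_compat; lra. }
destruct (Hc (Rmin 1 (eps / (2 * k)))) as [d2 [Hd2 K2]].
{ apply Rmin_pos; [lra|]. apply Rdiv_lt_0_compat; lra. }
exists (Rmin d2 (d1 / m)); split.
{ apply Rmin_pos; [lra|]. apply Rdiv_lt_0_compat; lra. }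
intros u Hu.
specialize (K2 u (Rlt_le_trans _ _ _ Hu (Rmin_l _ _))).
assert (Hu2 := Rlt_le_trans _ _ _ Hu (Rmin_r _ _)).
apply (Rmult_lt_compat_l m) in Hu2; [|lra].
replace (m * (d1 / m)) with d1 in Hu2 by (field; lra).
assert (Hcu : Cmod (c u - c t) <= m * Rabs (u - t)).
{ replace (c u - c t)%C with
    ((c u - c t - RtoC (u - t) * v) + RtoC (u - t) * v)%C by ring.
  refine (Rle_trans _ _ _ (Cmod_triangle _ _) _).
  rewrite Cmod_mult, Cmod_R.
  assert (H := Rmult_le_compat_r _ _ _ (Rabs_pos (u - t)) (Rmin_l 1 (eps / (2 * k)))).
  unfold m; lra. }
specialize (K1 (c u) ltac:(lra)).
replace (f (c u) - f (c t) - RtoC (u - t) * (l * v))%C with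
 ((f (c u) - f (c t) - (c u - c t) * l) + (c u - c t - RtoC (u - t) * v) * l)%C by ring.
refine (Rle_trans _ _ _ (Cmod_triangle _ _) _).
rewrite Cmod_mult.
assert (Ha : eps / (2 * m) * Cmod (c u - c t) <= eps / 2 * Rabs (u - t)).
{ replace (eps / 2 * Rabs (u - t)) with (eps / (2 * m) * (m * Rabs (u - t))) by (field; lra).
  apply Rmult_le_compat_l; [|exact Hcu].
  left; apply Rdiv_lt_0_compat; lra. }
assert (Hb : Cmod (c u - c t - RtoC (u - t) * v) * Cmod l <= eps / 2 * Rabs (u - t)).
{ replace (eps / 2 * Rabs (u - t)) with ((eps / (2 * k) * Rabs (u - t)) * k) by (field; lra).
  apply Rmult_le_compat; try apply Cmod_ge_0.
  - refine (Rle_trans _ _ _ K2 _).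
    apply Rmult_le_compat_r; [apply Rabs_pos|apply Rmin_r].
  - unfold k; lra. }
lra.
Qed.

Lemma nonincreasing_of_derive (f df : R -> R) (a b : R) :
  a <= b ->
  (forall t, a <= t <= b -> is_derive f t (df t)) ->
  (forall t, a <= t <= b -> df t <= 0) ->
  f b <= f a.
Proof.
intros Hab Hd Hs.
destruct (MVT_gen f a b df) as [c [Hc E]].
- intros x; rewrite Rmin_left, Rmax_right by exact Hab; intros Hx; apply Hd; lra.
- intros x; rewrite Rmin_left, Rmax_right by exact Hab; intros Hx.
  apply continuity_pt_filterlim, (ex_derive_continuous (K:=R_AbsRing) (V:=R_NormedModule) f).
  exists (df x); now apply Hd.
- rewrite Rmin_left, Rmax_right in Hc by exact Hab.
  specialize (Hs c Hc). nra.
Qed.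

(** The mean value inequality for curves: project the curve on the direction of its
    total increment and compare real functions. *)
Lemma Cmod_increment_le (c v : R -> C) (B dB : R -> R) (a b : R) :
  a <= b ->
  (forall t, a <= t <= b -> is_velocity c t (v t)) ->
  (forall t, a <= t <= b -> is_derive B t (dB t)) ->
  (forall t, a <= t <= b -> Cmod (v t) <= dB t) ->
  Cmod (c b - c a) <= B b - B a.
Proof.
intros Hab Hc HB Hv.
set (w := (c b - c a)%C).
destruct (Req_dec (Cmod w) 0) as [E|E].
{ rewrite E.
  assert (H := nonincreasing_of_derive (fun t => - B t) (fun t => - dB t) a b Hab).
  cut (- B b <= - B a); [lra|].
  apply H; intros t Ht.
  - now apply @is_derive_opp, HB.
  - generalize (Hv t Ht) (Cmod_ge_0 (v t)); lra. }
assert (Hw : 0 < Cmod w) by (generalize (Cmod_ge_0 w); lra).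
set (pr := fun z : C => Re w * Re z + Im w * Im z).
assert (Hpr : forall z, pr z <= Cmod w * Cmod z).
{ intros z. unfold pr.
  replace (Re w * Re z + Im w * Im z) with (Re (w * Cconj z)%C) by (unfold Re, Im; simpl; ring).
  rewrite <- (Cmod_conj z), <- Cmod_mult.
  refine (Rle_trans _ _ _ (Rle_abs _) (re_le_Cmod _)). }
assert (H := nonincreasing_of_derive (fun t => pr (c t) - Cmod w * B t)
   (fun t => pr (v t) - Cmod w * dB t) a b Hab).
assert (H' : pr (c b) - Cmod w * B b <= pr (c a) - Cmod w * B a).
{ apply H; intros t Ht.
  - destruct (proj1 (is_velocity_components _ _ _) (Hc t Ht)) as [H1 H2].
    apply (is_derive_minus (K:=R_AbsRing) (V:=R_NormedModule)).
    + apply (is_derive_plus (K:=R_AbsRing) (V:=R_NormedModule)).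
      * now apply (is_derive_scal (fun t => Re (c t))).
      * now apply (is_derive_scal (fun t => Im (c t))).
    + now apply is_derive_scal, HB.
  - generalize (Hpr (v t)) (Rmult_le_compat_l _ _ _ (Rlt_le _ _ Hw) (Hv t Ht)); lra. }
assert (E2 : pr (c b) - pr (c a) = Cmod w * Cmod w).
{ assert (H2 := Cmod2_alt w). simpl in H2. rewrite Rmult_1_r in H2. rewrite H2.
  unfold pr, w, Re, Im; simpl; ring. }
apply (Rmult_le_reg_l (Cmod w)); [exact Hw|]. lra.
Qed.
(** * Goursat's theorem *)

Lemma nested_intervals (l u : nat -> R) :
  (forall n, l n <= l (S n)) -> (forall n, u (S n) <= u n) ->
  (forall n, l n <= u n) -> exists x, forall n, l n <= x <= u n.
Proof.
intros Hl Hu Hlu.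
assert (Ml : forall n k, l n <= l (n + k)%nat).
{ intros n k; induction k as [|k IH]; [rewrite Nat.add_0_r; lra|].
  rewrite Nat.add_succ_r; generalize (Hl (n + k)%nat); lra. }
assert (Mu : forall n k, u (n + k)%nat <= u n).
{ intros n k; induction k as [|k IH]; [rewrite Nat.add_0_r; lra|].
  rewrite Nat.add_succ_r; generalize (Hu (n + k)%nat); lra. }
assert (Hb : forall n m, l m <= u n).
{ intros n m.
  generalize (Ml m n) (Hlu (m + n)%nat) (Mu n m); rewrite (Nat.add_comm n m); lra. }
destruct (completeness (fun x => exists n, x = l n)) as [x [H1 H2]].
- exists (u O); intros y [n ->]; apply Hb.
- exists (l O); now exists O.
- exists x; intros n; split; [apply H1; now exists n|].
  apply H2; intros y [m ->]; apply Hb.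
Qed.

Definition rectangle : Type := ((R * R) * (R * R))%type.

Definition rectangle_weight (Phi : R -> R -> R -> R -> C) (r : rectangle) : R :=
  Cmod (Phi (fst (fst r)) (snd (fst r)) (fst (snd r)) (snd (snd r))).

(** A quarter carrying at least a fourth of the weight; if the first three do not, the
    fourth one does by subadditivity. *)
Definition heavy_quarter (Phi : R -> R -> R -> R -> C) (r : rectangle) : rectangle :=
  let '((x1, x2), (y1, y2)) := r in
  let m := (x1 + x2) / 2 in let n := (y1 + y2) / 2 in
  let heavy q := Rle_dec (rectangle_weight Phi r / 4) (rectangle_weight Phi q) in
  if heavy ((x1, m), (y1, n)) then ((x1, m), (y1, n))
  else if heavy ((m, x2), (y1, n)) then ((m, x2), (y1, n))
  else if heavy ((x1, m), (n, y2)) then ((x1, m), (n, y2))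
  else ((m, x2), (n, y2)).

(** Goursat's argument without integrals: if [Phi] were nonzero on the whole rectangle,
    quartering would produce nested rectangles on which [Phi] decreases no faster than their
    area, against the hypothesis that its area density vanishes at their common point. *)
Lemma additive_rectangle_function_zero (Phi : R -> R -> R -> R -> C) (a b c d : R) :
  a <= b -> c <= d ->
  (forall x1 x2 y1 y2, a <= x1 -> x1 <= x2 -> x2 <= b ->
     c <= y1 -> y1 <= y2 -> y2 <= d ->
     let m := (x1 + x2) / 2 in let n := (y1 + y2) / 2 in
     Phi x1 x2 y1 y2 =
       (Phi x1 m y1 n + Phi m x2 y1 n + Phi x1 m n y2 + Phi m x2 n y2)%C) ->
  (forall x y, a <= x <= b -> c <= y <= d ->
     forall eps, 0 < eps -> exists delta, 0 < delta /\
     forall x1 x2 y1 y2, a <= x1 -> x1 <= x <= x2 -> x2 <= b ->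
       c <= y1 -> y1 <= y <= y2 -> y2 <= d ->
       x2 - x1 < delta -> y2 - y1 < delta ->
       Cmod (Phi x1 x2 y1 y2) <= eps * ((x2 - x1) + (y2 - y1)) ^ 2) ->
  Phi a b c d = 0.
Proof.
intros Hab Hcd Hadd Hder.
set (r := fix r (n : nat) : rectangle :=
  match n with O => ((a, b), (c, d)) | S n => heavy_quarter Phi (r n) end).
set (X1 := fun n => fst (fst (r n))). set (X2 := fun n => snd (fst (r n))).
set (Y1 := fun n => fst (snd (r n))). set (Y2 := fun n => snd (snd (r n))).
assert (step : forall n,
   a <= X1 n -> X1 n <= X2 n -> X2 n <= b ->
   c <= Y1 n -> Y1 n <= Y2 n -> Y2 n <= d ->
   X1 n <= X1 (S n) /\ X2 (S n) <= X2 n /\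
   Y1 n <= Y1 (S n) /\ Y2 (S n) <= Y2 n /\
   X2 (S n) - X1 (S n) = (X2 n - X1 n) / 2 /\
   Y2 (S n) - Y1 (S n) = (Y2 n - Y1 n) / 2 /\
   rectangle_weight Phi (r n) / 4 <= rectangle_weight Phi (r (S n))).
{ intros n.
  unfold X1, X2, Y1, Y2; change (r (S n)) with (heavy_quarter Phi (r n)).
  destruct (r n) as [[x1 x2] [y1 y2]]; simpl.
  intros h1 h2 h3 h4 h5 h6.
  assert (Hq : rectangle_weight Phi ((x1, x2), (y1, y2)) <=
    rectangle_weight Phi ((x1, (x1 + x2) / 2), (y1, (y1 + y2) / 2)) +
    rectangle_weight Phi (((x1 + x2) / 2, x2), (y1, (y1 + y2) / 2)) +
    rectangle_weight Phi ((x1, (x1 + x2) / 2), ((y1 + y2) / 2, y2)) +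
    rectangle_weight Phi (((x1 + x2) / 2, x2), ((y1 + y2) / 2, y2))).
  { unfold rectangle_weight at 1; simpl.
    rewrite (Hadd x1 x2 y1 y2 h1 h2 h3 h4 h5 h6).
    refine (Rle_trans _ _ _ (Cmod_triangle _ _) (Rplus_le_compat_r _ _ _ _)).
    refine (Rle_trans _ _ _ (Cmod_triangle _ _) (Rplus_le_compat_r _ _ _ _)).
    apply Cmod_triangle. }
  unfold heavy_quarter; simpl.
  destruct (Rle_dec _ _) as [K1|K1]; [simpl; repeat split; try lra|].
  destruct (Rle_dec _ _) as [K2|K2]; [simpl; repeat split; try lra|].
  destruct (Rle_dec _ _) as [K3|K3]; simpl; repeat split; try lra. }
assert (inv : forall n,
   a <= X1 n /\ X1 n <= X2 n /\ X2 n <= b /\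
   c <= Y1 n /\ Y1 n <= Y2 n /\ Y2 n <= d /\
   X2 n - X1 n = (b - a) * (/ 2) ^ n /\
   Y2 n - Y1 n = (d - c) * (/ 2) ^ n /\
   Cmod (Phi a b c d) * ((/ 2) ^ n) ^ 2 <= rectangle_weight Phi (r n)).
{ induction n as [|n IH].
  - unfold X1, X2, Y1, Y2, rectangle_weight; simpl; repeat split; try lra.
  - destruct IH as (h1 & h2 & h3 & h4 & h5 & h6 & h7 & h8 & h9).
    destruct (step n h1 h2 h3 h4 h5 h6) as (k1 & k2 & k3 & k4 & k5 & k6 & k7).
    rewrite h7 in k5; rewrite h8 in k6.
    simpl ((/ 2) ^ S n); repeat split; try lra.
    }
destruct (nested_intervals X1 X2) as [x Hx].
{ intros n; now destruct (inv n) as (? & ? & ? & ? & ? & ? & _); apply step. }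
{ intros n; now destruct (inv n) as (? & ? & ? & ? & ? & ? & _); apply step. }
{ intros n; apply (inv n). }
destruct (nested_intervals Y1 Y2) as [y Hy].
{ intros n; now destruct (inv n) as (? & ? & ? & ? & ? & ? & _); apply step. }
{ intros n; now destruct (inv n) as (? & ? & ? & ? & ? & ? & _); apply step. }
{ intros n; apply (inv n). }
apply Cmod_eq_0, Rle_antisym; [|apply Cmod_ge_0].
apply Rnot_lt_le; intros Hpos.
(* The [+ 1] keeps the quotients meaningful for a degenerate rectangle. *)
set (L := (b - a) + (d - c)).
assert (HL : 0 <= L) by (unfold L; lra).
assert (HL2 : 0 <= L ^ 2) by apply pow2_ge_0.
destruct (Hder x y (Hx O) (Hy O) (Cmod (Phi a b c d) / (2 * (L ^ 2 + 1)))) as [delta [Hd0 Hd]].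
{ apply Rdiv_lt_0_compat; lra. }
destruct (pow_lt_1_zero (/ 2)) with (y := delta / (L + 1)) as [n Hn].
{ rewrite Rabs_pos_eq; lra. }
{ apply Rdiv_lt_0_compat; lra. }
specialize (Hn n (Nat.le_refl n)).
assert (Hp : 0 < (/ 2) ^ n) by (apply pow_lt; lra).
rewrite Rabs_pos_eq in Hn by lra.
apply (Rmult_lt_compat_l (L + 1)) in Hn; [|lra].
replace ((L + 1) * (delta / (L + 1))) with delta in Hn by (field; lra).
destruct (inv n) as (h1 & h2 & h3 & h4 & h5 & h6 & h7 & h8 & h9).
assert (Hb := Hd (X1 n) (X2 n) (Y1 n) (Y2 n) h1 (Hx n) h3 h4 (Hy n) h6).
rewrite h7, h8 in Hb.
assert (Hb' : rectangle_weight Phi (r n) <= Cmod (Phi a b c d) / (2 * (L ^ 2 + 1)) *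
         ((b - a) * (/ 2) ^ n + (d - c) * (/ 2) ^ n) ^ 2).
{ apply Hb.
  - apply Rle_lt_trans with ((L + 1) * (/ 2) ^ n); [|exact Hn].
    apply Rmult_le_compat_r; unfold L; lra.
  - apply Rle_lt_trans with ((L + 1) * (/ 2) ^ n); [|exact Hn].
    apply Rmult_le_compat_r; unfold L; lra. }
replace ((b - a) * (/ 2) ^ n + (d - c) * (/ 2) ^ n) with (L * (/ 2) ^ n) in Hb'
  by (unfold L; ring).
assert (Hfin : Cmod (Phi a b c d) <= Cmod (Phi a b c d) / (2 * (L ^ 2 + 1)) * L ^ 2).
{ apply (Rmult_le_reg_r (((/ 2) ^ n) ^ 2)); [now apply pow_lt|].
  rewrite Rpow_mult_distr in Hb'. lra. }
assert (Hlt : Cmod (Phi a b c d) / (2 * (L ^ 2 + 1)) * L ^ 2 <= Cmod (Phi a b c d) / 2).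
{ replace (Cmod (Phi a b c d) / 2) with
    (Cmod (Phi a b c d) / (2 * (L ^ 2 + 1)) * (L ^ 2 + 1)) by (field; lra).
  apply Rmult_le_compat_l; [|lra].
  left; apply Rdiv_lt_0_compat; lra. }
lra.
Qed.
(** Integrals of curves are taken in [C] as a real Banach space, whose topology is the
    product topology. *)
Notation CRInt := (@RInt C_R_CompleteNormedModule).
Notation ex_CRInt := (@ex_RInt C_R_NormedModule).
Notation Ccontinuous := (@continuous _ C_UniformSpace).

Lemma Ccontinuous_components {U : UniformSpace} (c : U -> C) (x : U) :
  Ccontinuous c x <->
  continuous (fun y => Re (c y)) x /\ continuous (fun y => Im (c y)) x.
Proof.
split.
- intros H; split.
  + exact (continuous_comp c fst x H (continuous_fst (U:=R_UniformSpace)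
      (V:=R_UniformSpace) (Re (c x)) (Im (c x)))).
  + exact (continuous_comp c snd x H (continuous_snd (U:=R_UniformSpace)
      (V:=R_UniformSpace) (Re (c x)) (Im (c x)))).
- intros [H1 H2].
  apply (filterlim_locally c (c x)); intros eps.
  assert (K1 := proj1 (filterlim_locally _ _) H1 eps).
  assert (K2 := proj1 (filterlim_locally _ _) H2 eps).
  generalize (filter_and _ _ K1 K2); apply filter_imp; intros y [h1 h2].
  split; [exact h1|exact h2].
Qed.

Lemma Ccontinuous_mult {U : UniformSpace} (c d : U -> C) (x : U) :
  Ccontinuous c x -> Ccontinuous d x -> Ccontinuous (fun y => (c y * d y)%C) x.
Proof.
rewrite !Ccontinuous_components; intros [c1 c2] [d1 d2]; split.
- apply (continuous_minus (V:=R_NormedModule)).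
  + now apply (continuous_mult (K:=R_AbsRing) (fun y => Re (c y)) (fun y => Re (d y))).
  + now apply (continuous_mult (K:=R_AbsRing) (fun y => Im (c y)) (fun y => Im (d y))).
- apply (continuous_plus (V:=R_NormedModule)).
  + now apply (continuous_mult (K:=R_AbsRing) (fun y => Re (c y)) (fun y => Im (d y))).
  + now apply (continuous_mult (K:=R_AbsRing) (fun y => Im (c y)) (fun y => Re (d y))).
Qed.

Lemma is_velocity_continuous (c : R -> C) (t : R) (v : C) :
  is_velocity c t v -> Ccontinuous c t.
Proof.
intros H; exact (ex_derive_continuous (V:=C_R_NormedModule) c t (ex_intro _ v H)).
Qed.

Lemma ex_CRInt_of_continuous (c : R -> C) (a b : R) :
  a <= b -> (forall t, a <= t <= b -> Ccontinuous c t) -> ex_CRInt c a b.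
Proof.
intros Hab H; apply (ex_RInt_continuous (V:=C_R_CompleteNormedModule)).
now rewrite Rmin_left, Rmax_right by exact Hab.
Qed.

(** All explicit derivatives below come with a second-order remainder. *)
Lemma is_Cderive_quadratic (f : C -> C) (z l : C) (K r : R) :
  0 < r ->
  (forall w, Cmod (w - z) < r ->
     Cmod (f w - f z - (w - z) * l) <= K * Cmod (w - z) ^ 2) ->
  is_Cderive f z l.
Proof.
intros Hr H; apply is_Cderive_eps; intros eps Heps.
set (k := Rabs K + 1).
assert (Hk : 0 < k) by (generalize (Rabs_pos K); unfold k; lra).
exists (Rmin r (eps / k)); split.
{ apply Rmin_pos; [exact Hr|apply Rdiv_lt_0_compat; lra]. }
intros w Hw.
refine (Rle_trans _ _ _ (H w (Rlt_le_trans _ _ _ Hw (Rmin_l _ _))) _).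
assert (Hw2 := Rlt_le_trans _ _ _ Hw (Rmin_r _ _)).
apply (Rmult_lt_compat_l k) in Hw2; [|lra].
replace (k * (eps / k)) with eps in Hw2 by (field; lra).
simpl; rewrite Rmult_1_r, <- Rmult_assoc.
apply Rmult_le_compat_r; [apply Cmod_ge_0|].
apply Rle_trans with (k * Cmod (w - z)); [|lra].
apply Rmult_le_compat_r; [apply Cmod_ge_0|].
generalize (Rle_abs K); unfold k; lra.
Qed.

Lemma CRInt_Chasles (c : R -> C) (x y z : R) :
  ex_CRInt c x y -> ex_CRInt c y z ->
  CRInt c x z = (CRInt c x y + CRInt c y z)%C.
Proof.
intros H1 H2; symmetry; exact (RInt_Chasles (V:=C_R_CompleteNormedModule) c x y z H1 H2).
Qed.

(** [psi] is exact, so only the part [k - psi] contributes to the error. *)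
Lemma CRInt_approx (k Psi psi : R -> C) (a b M : R) :
  a <= b ->
  (forall t, a <= t <= b -> Ccontinuous k t) ->
  (forall t, a <= t <= b -> is_velocity Psi t (psi t)) ->
  (forall t, a <= t <= b -> Ccontinuous psi t) ->
  (forall t, a <= t <= b -> Cmod (k t - psi t) <= M) ->
  Cmod (CRInt k a b - (Psi b - Psi a)) <= (b - a) * M.
Proof.
intros Hab Hk HP Hpsi HM.
rewrite Cmod_norm.
apply (norm_RInt_le_const (V:=C_R_NormedModule) (fun t => (k t - psi t)%C)); [exact Hab| |].
- intros x Hx; rewrite <- Cmod_norm; now apply HM.
- apply (is_RInt_minus (V:=C_R_NormedModule) k psi).
  + apply (RInt_correct (V:=C_R_CompleteNormedModule)); now apply ex_CRInt_of_continuous.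
  + apply (is_RInt_derive (V:=C_R_CompleteNormedModule) Psi psi);
      now rewrite Rmin_left, Rmax_right by exact Hab.
Qed.

Definition affine_primitive (z0 A B : C) (z : C) : C :=
  (A * z + B * ((z - z0) * (z - z0)) / 2)%C.

Lemma is_Cderive_affine_primitive (z0 A B z : C) :
  is_Cderive (affine_primitive z0 A B) z (A + (z - z0) * B)%C.
Proof.
apply is_Cderive_quadratic with (K := Cmod (B / 2)) (r := 1); [lra|].
intros w _; right.
rewrite <- Cmod_pow, <- Cmod_mult; f_equal.
unfold affine_primitive; field.
Qed.

Lemma is_Cderive_affine (z0 A B z : C) :
  is_Cderive (fun z => A + (z - z0) * B)%C z B.
Proof.
apply is_Cderive_quadratic with (K := 0) (r := 1); [lra|].
intros w _; rewrite Rmult_0_l; right.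
rewrite <- Cmod_0; f_equal; ring.
Qed.

(** Near [z0] the form [g dz] is the exact form [(A + B (z - z0)) dz] up to a small multiple
    of [|z - z0|]; along an edge, the exact part only sees the end points. *)
Lemma edge_estimate (g : C -> C) (z0 A B : C) (eps delta : R) (c v : R -> C)
    (a b L D : R) :
  0 <= eps ->
  (forall w, Cmod (w - z0) < delta ->
     Cmod (g w - A - (w - z0) * B) <= eps * Cmod (w - z0)) ->
  a <= b ->
  (forall t, a <= t <= b -> is_velocity c t (v t)) ->
  (forall t, a <= t <= b -> Ccontinuous v t) ->
  (forall t, a <= t <= b -> Ccontinuous (fun u => g (c u)) t) ->
  (forall t, a <= t <= b -> Cmod (v t) <= L) ->
  (forall t, a <= t <= b -> Cmod (c t - z0) <= D) ->
  D < delta ->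
  Cmod (CRInt (fun t => g (c t) * v t)%C a b
        - (affine_primitive z0 A B (c b) - affine_primitive z0 A B (c a)))
    <= (b - a) * (eps * D * L).
Proof.
intros Heps Hg Hab Hc Hv Hgc HL HD Hdelta.
apply CRInt_approx with (k := fun t => (g (c t) * v t)%C)
  (Psi := fun t => affine_primitive z0 A B (c t))
  (psi := fun t => ((A + (c t - z0) * B) * v t)%C); [exact Hab| | | |].
- intros t Ht; apply Ccontinuous_mult; [now apply Hgc|now apply Hv].
- intros t Ht; apply (is_velocity_comp (affine_primitive z0 A B) c);
    [apply is_Cderive_affine_primitive|now apply Hc].
- intros t Ht; apply (Ccontinuous_mult (fun t => (A + (c t - z0) * B)%C)); [|now apply Hv].
  eapply is_velocity_continuous.
  apply (is_velocity_comp (fun z => (A + (z - z0) * B)%C) c);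
    [apply is_Cderive_affine|now apply Hc].
- intros t Ht.
  replace (g (c t) * v t - (A + (c t - z0) * B) * v t)%C with
    ((g (c t) - A - (c t - z0) * B) * v t)%C by ring.
  rewrite Cmod_mult.
  specialize (HD t Ht).
  apply Rmult_le_compat; try apply Cmod_ge_0; [|now apply HL].
  refine (Rle_trans _ _ _ (Hg _ _) _); [lra|].
  now apply Rmult_le_compat_l.
Qed.

(** The form [P ds + Q dt] integrated counterclockwise along the rectangle
    [[x1, x2] x [y1, y2]]. *)
Definition boundary_integral (P Q : R -> R -> C) (x1 x2 y1 y2 : R) : C :=
  (CRInt (fun s => P s y1) x1 x2 + CRInt (Q x2) y1 y2
   - CRInt (fun s => P s y2) x1 x2 - CRInt (Q x1) y1 y2)%C.

Lemma boundary_integral_bisection (P Q : R -> R -> C) (a b c d x1 x2 y1 y2 : R) :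
  (forall s t, a <= s <= b -> c <= t <= d -> Ccontinuous (fun s => P s t) s) ->
  (forall s t, a <= s <= b -> c <= t <= d -> Ccontinuous (Q s) t) ->
  a <= x1 -> x1 <= x2 -> x2 <= b -> c <= y1 -> y1 <= y2 -> y2 <= d ->
  let m := (x1 + x2) / 2 in let n := (y1 + y2) / 2 in
  boundary_integral P Q x1 x2 y1 y2 =
    (boundary_integral P Q x1 m y1 n + boundary_integral P Q m x2 y1 n
     + boundary_integral P Q x1 m n y2 + boundary_integral P Q m x2 n y2)%C.
Proof.
intros HP HQ h1 h2 h3 h4 h5 h6 m n.
assert (Hm : x1 <= m <= x2) by (unfold m; lra).
assert (Hn : y1 <= n <= y2) by (unfold n; lra).
assert (EP : forall t, c <= t <= d -> CRInt (fun s => P s t) x1 x2 =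
   (CRInt (fun s => P s t) x1 m + CRInt (fun s => P s t) m x2)%C).
{ intros t Ht; apply CRInt_Chasles; apply ex_CRInt_of_continuous; try lra;
    intros s Hs; apply HP; lra. }
assert (EQ : forall s, a <= s <= b -> CRInt (Q s) y1 y2 =
   (CRInt (Q s) y1 n + CRInt (Q s) n y2)%C).
{ intros s Hs; apply CRInt_Chasles; apply ex_CRInt_of_continuous; try lra;
    intros t Ht; apply HQ; lra. }
unfold boundary_integral.
rewrite (EP y1), (EP y2), (EQ x1), (EQ x2) by lra.
ring.
Qed.

(** Goursat's theorem for a homotopy: the pull-back of [g dz] by [H] integrates to zero
    along the boundary of the parameter rectangle.  Bisecting the parameters, rather than a
    region of the plane, lets one statement cover every deformation of contours. *)
Theorem closed_form_boundary_integral (g g' : C -> C) (H Hs Ht : R -> R -> C)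
    (a b c d L : R) :
  a <= b -> c <= d -> 0 <= L ->
  (forall s t, a <= s <= b -> c <= t <= d ->
     is_velocity (fun s => H s t) s (Hs s t) /\
     is_velocity (fun t => H s t) t (Ht s t) /\
     Ccontinuous (fun s => Hs s t) s /\ Ccontinuous (fun t => Ht s t) t /\
     Cmod (Hs s t) <= L /\ Cmod (Ht s t) <= L /\
     is_Cderive g (H s t) (g' (H s t))) ->
  boundary_integral (fun s t => g (H s t) * Hs s t)%C
                    (fun s t => g (H s t) * Ht s t)%C a b c d = 0.
Proof.
intros Hab Hcd HL Hyp.
assert (Cgs : forall s t, a <= s <= b -> c <= t <= d -> Ccontinuous (fun s => g (H s t)) s).
{ intros s t hs ht; destruct (Hyp s t hs ht) as (v1 & v2 & c1 & c2 & l1 & l2 & dg).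
  eapply is_velocity_continuous, is_velocity_comp; [exact dg|exact v1]. }
assert (Cgt : forall s t, a <= s <= b -> c <= t <= d -> Ccontinuous (fun t => g (H s t)) t).
{ intros s t hs ht; destruct (Hyp s t hs ht) as (v1 & v2 & c1 & c2 & l1 & l2 & dg).
  eapply is_velocity_continuous, is_velocity_comp; [exact dg|exact v2]. }
assert (Lip : forall s t x y, a <= s <= b -> c <= t <= d -> a <= x <= b -> c <= y <= d ->
   Cmod (H s t - H x y) <= L * (Rabs (s - x) + Rabs (t - y))).
{ assert (L1 : forall s x y, a <= s -> s <= x -> x <= b -> c <= y <= d ->
     Cmod (H x y - H s y) <= L * (x - s)).
  { intros s x y k1 k2 k3 k4.
    replace (L * (x - s)) with (L * x - L * s) by ring.
    apply (Cmod_increment_le (fun s => H s y) (fun s => Hs s y) (fun s => L * s) (fun _ => L));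
      [exact k2| | |].
    - intros t ht; apply Hyp; lra.
    - intros t ht; auto_derive; [trivial|ring].
    - intros t ht; apply (Hyp t y); lra. }
  assert (L2 : forall s t y, a <= s <= b -> c <= t -> t <= y -> y <= d ->
     Cmod (H s y - H s t) <= L * (y - t)).
  { intros s t y k1 k2 k3 k4.
    replace (L * (y - t)) with (L * y - L * t) by ring.
    apply (Cmod_increment_le (fun t => H s t) (fun t => Ht s t) (fun t => L * t) (fun _ => L));
      [exact k3| | |].
    - intros u hu; apply Hyp; lra.
    - intros u hu; auto_derive; [trivial|ring].
    - intros u hu; apply (Hyp s u); lra. }
  intros s t x y k1 k2 k3 k4.
  replace (H s t - H x y)%C with ((H s t - H x t) + (H x t - H x y))%C by ring.
  refine (Rle_trans _ _ _ (Cmod_triangle _ _) _).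
  rewrite Rmult_plus_distr_l; apply Rplus_le_compat.
  - destruct (Rle_dec s x).
    + rewrite Cmod_sub_comm, Rabs_minus_sym, Rabs_pos_eq by lra; apply L1; lra.
    + rewrite Rabs_pos_eq by lra; apply L1; lra.
  - destruct (Rle_dec t y).
    + rewrite Cmod_sub_comm, Rabs_minus_sym, Rabs_pos_eq by lra; apply L2; lra.
    + rewrite Rabs_pos_eq by lra; apply L2; lra. }
(* The form is exact to first order at every point, so its rectangle function has zero
   area density. *)
apply additive_rectangle_function_zero; [exact Hab|exact Hcd| |].
{ intros x1 x2 y1 y2 h1 h2 h3 h4 h5 h6.
  apply boundary_integral_bisection with a b c d; trivial.
  - intros s t hs ht; apply Ccontinuous_mult; [now apply Cgs|apply Hyp; assumption].
  - intros s t hs ht; apply Ccontinuous_mult; [now apply Cgt|apply Hyp; assumption]. }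
intros x y Hx Hy eps Heps.
destruct (Hyp x y Hx Hy) as (_ & _ & _ & _ & _ & _ & dg).
set (e := eps / (2 * (L * L + 1))).
assert (HLL : 0 <= L * L) by now apply Rmult_le_pos.
assert (He : 0 < e) by (apply Rdiv_lt_0_compat; lra).
destruct (proj1 (is_Cderive_eps g (H x y) _) dg e He) as [d0 [Hd0 Hg]].
exists (d0 / (2 * (L + 1))); split; [apply Rdiv_lt_0_compat; lra|].
intros x1 x2 y1 y2 h1 h2 h3 h4 h5 h6 h7 h8.
set (D := x2 - x1 + (y2 - y1)).
assert (HD : L * D < d0).
{ apply Rle_lt_trans with ((L + 1) * D); [apply Rmult_le_compat_r; unfold D; lra|].
  replace d0 with ((L + 1) * (d0 / (2 * (L + 1)) + d0 / (2 * (L + 1)))) by (field; lra).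
  apply Rmult_lt_compat_l; unfold D; lra. }
assert (near : forall s t, x1 <= s <= x2 -> y1 <= t <= y2 ->
   Cmod (H s t - H x y) <= L * D).
{ intros s t hs ht.
  refine (Rle_trans _ _ _ (Lip s t x y _ _ _ _) _); try lra.
  apply Rmult_le_compat_l; [exact HL|].
  unfold D; apply Rplus_le_compat; apply Rabs_le; lra. }
assert (E1 : forall t, y1 <= t <= y2 ->
  Cmod (CRInt (fun s => g (H s t) * Hs s t)%C x1 x2
    - (affine_primitive (H x y) (g (H x y)) (g' (H x y)) (H x2 t)
       - affine_primitive (H x y) (g (H x y)) (g' (H x y)) (H x1 t)))
   <= (x2 - x1) * (e * (L * D) * L)).
{ intros t ht.
  apply (edge_estimate g (H x y) (g (H x y)) (g' (H x y)) e d0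
     (fun s => H s t) (fun s => Hs s t)); try assumption; try lra.
  - intros s hs; apply Hyp; lra.
  - intros s hs; apply Hyp; lra.
  - intros s hs; apply Cgs; lra.
  - intros s hs; apply (Hyp s t); lra.
  - intros s hs; apply near; lra. }
assert (E2 : forall s, x1 <= s <= x2 ->
  Cmod (CRInt (fun t => g (H s t) * Ht s t)%C y1 y2
    - (affine_primitive (H x y) (g (H x y)) (g' (H x y)) (H s y2)
       - affine_primitive (H x y) (g (H x y)) (g' (H x y)) (H s y1)))
   <= (y2 - y1) * (e * (L * D) * L)).
{ intros s hs.
  apply (edge_estimate g (H x y) (g (H x y)) (g' (H x y)) e d0
     (fun t => H s t) (fun t => Ht s t)); try assumption; try lra.
  - intros t ht; apply Hyp; lra.
  - intros t ht; apply Hyp; lra.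
  - intros t ht; apply Cgt; lra.
  - intros t ht; apply (Hyp s t); lra.
  - intros t ht; apply near; lra. }
assert (F1 := E1 y1 ltac:(lra)). assert (F3 := E1 y2 ltac:(lra)).
assert (F2 := E2 x2 ltac:(lra)). assert (F4 := E2 x1 ltac:(lra)).
unfold boundary_integral.
match type of F1 with Cmod ?u <= _ => set (z1 := u) in F1 end.
match type of F2 with Cmod ?u <= _ => set (z2 := u) in F2 end.
match type of F3 with Cmod ?u <= _ => set (z3 := u) in F3 end.
match type of F4 with Cmod ?u <= _ => set (z4 := u) in F4 end.
match goal with |- Cmod ?u <= _ => replace u with (z1 + z2 + - z3 + - z4)%C
  by (unfold z1, z2, z3, z4; ring) end.
apply Rle_trans with (Cmod z1 + Cmod z2 + Cmod z3 + Cmod z4).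
{ rewrite <- (Cmod_opp z3), <- (Cmod_opp z4).
  refine (Rle_trans _ _ _ (Cmod_triangle _ _) (Rplus_le_compat_r _ _ _ _)).
  refine (Rle_trans _ _ _ (Cmod_triangle _ _) (Rplus_le_compat_r _ _ _ _)).
  apply Cmod_triangle. }
apply Rle_trans with (2 * e * (L * L) * D ^ 2).
{ replace (2 * e * (L * L) * D ^ 2) with
   ((x2 - x1) * (e * (L * D) * L) + (y2 - y1) * (e * (L * D) * L) +
    (x2 - x1) * (e * (L * D) * L) + (y2 - y1) * (e * (L * D) * L))
   by (unfold D; ring). lra. }
change (2 * e * (L * L) * D ^ 2 <= eps * D ^ 2).
apply Rmult_le_compat_r; [apply pow2_ge_0|].
replace eps with (2 * e * (L * L + 1)) by (unfold e; field; lra).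
apply Rmult_le_compat_l; lra.
Qed.

(** * Cauchy's formula *)

(** The product and chain rules are stated for the ring structure of [C]. *)
Lemma is_Cderive_ring (f : C -> C) (z l : C) :
  is_Cderive f z l <-> @is_derive C_AbsRing (AbsRing_NormedModule C_AbsRing) f z l.
Proof.
rewrite is_Cderive_eps; symmetry.
exact (is_derive_eps (V := AbsRing_NormedModule C_AbsRing) f z l).
Qed.

Lemma is_Cderive_mult (f g : C -> C) (z l m : C) :
  is_Cderive f z l -> is_Cderive g z m ->
  is_Cderive (fun w => f w * g w)%C z (l * g z + f z * m)%C.
Proof.
rewrite !is_Cderive_ring; intros Hf Hg.
apply (is_derive_mult (K := C_AbsRing) f g z l m Hf Hg).
exact Cmult_comm.
Qed.

Lemma Cmod_triangle_sub (z w : C) : Cmod z - Cmod w <= Cmod (z - w).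
Proof.
generalize (Cmod_triangle (z - w) w).
replace (z - w + w)%C with z by ring; lra.
Qed.

Lemma Cmod_pos_neq (z : C) : 0 < Cmod z -> z <> 0%C.
Proof. apply Cmod_gt_0. Qed.

Lemma is_Cderive_inv (z : C) :
  z <> 0%C -> is_Cderive (fun w => / w)%C z (- / (z * z))%C.
Proof.
intros Hz; assert (Hm := proj1 (Cmod_gt_0 z) Hz).
apply is_Cderive_quadratic with (K := 2 / Cmod z ^ 3) (r := Cmod z / 2); [lra|].
intros w Hw.
assert (Hw2 : Cmod z / 2 <= Cmod w).
{ generalize (Cmod_triangle_sub z w); rewrite Cmod_sub_comm; lra. }
assert (Hw0 : w <> 0%C) by (apply Cmod_pos_neq; lra).
replace (/ w - / z - (w - z) * - / (z * z))%C with ((w - z) ^ 2 / (z * z * w))%C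
  by (field; split; assumption).
rewrite Cmod_div, Cmod_pow, !Cmod_mult by (repeat apply Cmult_neq_0; assumption).
replace (2 / Cmod z ^ 3 * Cmod (w - z) ^ 2) with
  (Cmod (w - z) ^ 2 / (Cmod z * Cmod z * (Cmod z / 2))) by (field; lra).
apply Rmult_le_compat_l; [apply pow2_ge_0|].
apply Rinv_le_contravar.
- repeat apply Rmult_lt_0_compat; lra.
- apply Rmult_le_compat_l; [|exact Hw2]. left; apply Rmult_lt_0_compat; lra.
Qed.

Lemma is_Cderive_id (z : C) : is_Cderive (fun w => w) z (RtoC 1).
Proof.
apply is_Cderive_quadratic with (K := 0) (r := 1); [lra|].
intros w _; rewrite Rmult_0_l; right.
rewrite <- Cmod_0; f_equal; ring.
Qed.

Lemma is_Cderive_const (a z : C) : is_Cderive (fun _ => a) z (RtoC 0).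
Proof. exact (is_derive_const (V := C_NormedModule) a z). Qed.

Lemma is_Cderive_plus (f g : C -> C) (z l m : C) :
  is_Cderive f z l -> is_Cderive g z m ->
  is_Cderive (fun w => f w + g w)%C z (l + m)%C.
Proof. exact (is_derive_plus (V := C_NormedModule) f g z l m). Qed.

Lemma is_Cderive_minus (f g : C -> C) (z l m : C) :
  is_Cderive f z l -> is_Cderive g z m ->
  is_Cderive (fun w => f w - g w)%C z (l - m)%C.
Proof. exact (is_derive_minus (V := C_NormedModule) f g z l m). Qed.

Lemma is_Cderive_div (f g : C -> C) (z l m : C) :
  is_Cderive f z l -> is_Cderive g z m -> g z <> 0%C ->
  is_Cderive (fun w => f w / g w)%C z ((l * g z - f z * m) / (g z * g z))%C.
Proof.
intros Hf Hg H0.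
replace ((l * g z - f z * m) / (g z * g z))%C with
  (l * / g z + f z * (m * - / (g z * g z)))%C by (field; exact H0).
apply (is_Cderive_mult f (fun w => / g w)%C); [exact Hf|].
exact (is_derive_comp (K := C_AbsRing) (V := C_NormedModule) (fun w => / w)%C g z
  _ _ (is_Cderive_inv _ H0) (proj1 (is_Cderive_ring _ _ _) Hg)).
Qed.

Lemma Cmod_cis (t : R) : Cmod (cis t) = 1.
Proof.
unfold Cmod, cis; simpl.
generalize (sin2_cos2 t); unfold Rsqr; intros H.
replace (_ + _) with 1 by lra; apply sqrt_1.
Qed.

Lemma is_velocity_cis (t : R) : is_velocity cis t (Ci * cis t)%C.
Proof.
apply is_velocity_components; unfold Re, Im; simpl; split; auto_derive; trivial; ring.
Qed.

Lemma cis_2PI : cis (2 * PI) = cis 0.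
Proof. unfold cis; now rewrite cos_2PI, sin_2PI, cos_0, sin_0. Qed.

Lemma continuous_cis (t : R) : Ccontinuous cis t.
Proof. eapply is_velocity_continuous, is_velocity_cis. Qed.

Lemma analytic_is_Cderive (f : C -> C) (z : C) :
  analytic f -> disk z -> is_Cderive f z (C_derive f z).
Proof. intros Hf Hz; exact (C_derive_correct f z z (Hf z Hz)). Qed.

(** The circle of radius [rho] about 0 is deformed into the circle of radius [eps] about
    [z] along straight segments; since [|z| + eps <= rho] these never meet [z], where
    [f(w) / (w - z)] is singular. *)
Lemma cauchy_circles (f : C -> C) (z : C) (rho eps : R) :
  analytic f -> 0 < eps -> Cmod z + eps <= rho -> rho < 1 ->
  CRInt (fun t => f (rho * cis t) / (rho * cis t - z) * (rho * (Ci * cis t)))%C 0 (2 * PI)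
  = CRInt (fun t => f (z + eps * cis t) / (z + eps * cis t - z) * (eps * (Ci * cis t)))%C
      0 (2 * PI).
Proof.
intros Hf Heps Hz Hrho.
assert (HPI := PI_RGT_0). assert (Hz0 := Cmod_ge_0 z).
set (rad := fun s : R => (1 - s) * eps + s * rho).
set (H := fun s t : R => ((1 - s)%R * z + rad s * cis t)%C).
set (Hs := fun s t : R => (- z + (rho - eps)%R * cis t)%C).
set (Ht := fun s t : R => (rad s * (Ci * cis t))%C).
set (g := fun w => (f w / (w - z))%C).
set (g' := fun w => ((C_derive f w * (w - z) - f w * (1 - 0)) / ((w - z) * (w - z)))%C).
assert (Hrad : forall s, 0 <= s <= 1 -> eps <= rad s <= rho).
{ intros s hs; unfold rad; split; nra. }
assert (K := closed_form_boundary_integral g g' H Hs Ht 0 1 0 (2 * PI) 3).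
assert (E : boundary_integral (fun s t => g (H s t) * Hs s t)%C
                    (fun s t => g (H s t) * Ht s t)%C 0 1 0 (2 * PI) = 0).
{ apply K; try lra; clear K.
  intros s t hs ht; specialize (Hrad s hs).
  split; [|split; [|split; [|split; [|split; [|split]]]]].
  - apply is_velocity_components; unfold H, Hs, rad, Re, Im, cis; simpl; split;
      auto_derive; trivial; ring.
  - apply is_velocity_components; unfold H, Ht, rad, Re, Im, cis; simpl; split;
      auto_derive; trivial; ring.
  - apply continuous_const.
  - unfold Ht; apply (Ccontinuous_mult (fun _ => RtoC (rad s))); [apply continuous_const|].
    apply (Ccontinuous_mult (fun _ => Ci)); [apply continuous_const|apply continuous_cis].
  - unfold Hs; refine (Rle_trans _ _ _ (Cmod_triangle _ _) _).
    rewrite Cmod_opp, Cmod_mult, Cmod_cis, Cmod_R, Rabs_pos_eq; lra.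
  - unfold Ht; rewrite !Cmod_mult, Cmod_cis, Cmod_R, Cmod_Ci, Rabs_pos_eq; lra.
  - assert (HD : disk (H s t)).
    { unfold disk, H; refine (Rle_lt_trans _ _ _ (Cmod_triangle _ _) _).
      rewrite !Cmod_mult, Cmod_cis, !Cmod_R, !Rabs_pos_eq by lra.
      unfold rad; nra. }
    apply (is_Cderive_div f (fun w => w - z)%C).
    + now apply analytic_is_Cderive.
    + apply (is_Cderive_minus (fun w => w) (fun _ => z));
        [apply is_Cderive_id|apply is_Cderive_const].
    + apply Cmod_pos_neq.
      replace (H s t - z)%C with (rad s * cis t - s * z)%C
        by (unfold H; rewrite RtoC_minus; ring).
      refine (Rlt_le_trans _ _ _ _ (Cmod_triangle_sub _ _)).
      rewrite !Cmod_mult, Cmod_cis, !Cmod_R, !Rabs_pos_eq by lra.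
      unfold rad; nra. }
unfold boundary_integral in E.
(* The sides [t = 0] and [t = 2 PI] are the same path, so their integrals cancel. *)
replace (fun s => g (H s (2 * PI)%R) * Hs s (2 * PI)%R)%C
   with (fun s => g (H s 0%R) * Hs s 0%R)%C in E
   by (unfold H, Hs; now rewrite cis_2PI).
assert (E2 : CRInt (fun t => g (H 1 t) * Ht 1 t)%C 0 (2 * PI)
           = CRInt (fun t => g (H 0 t) * Ht 0 t)%C 0 (2 * PI)).
{ match type of E with (?a + ?b - _ - ?c)%C = _ =>
    replace b with ((a + b - a - c) + c)%C by ring end.
  rewrite E; apply Cplus_0_l. }
assert (H1 : forall t, H 1 t = (rho * cis t)%C).
{ intros t; unfold H, rad; apply injective_projections; simpl; ring. }
assert (H0 : forall t, H 0 t = (z + eps * cis t)%C).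
{ intros t; unfold H, rad; apply injective_projections; simpl; ring. }
transitivity (CRInt (fun t => g (H 1 t) * Ht 1 t)%C 0 (2 * PI)); [|rewrite E2];
  apply (RInt_ext (V := C_R_CompleteNormedModule)); intros t _; rewrite ?H0, ?H1;
  unfold g, Ht, rad.
- now replace ((1 - 1) * eps + 1 * rho) with rho by ring.
- now replace ((1 - 0) * eps + 0 * rho) with eps by ring.
Qed.

(** Let [eps] tend to 0: on the small circle the integrand is [i f(z + eps e^{it})]. *)
Lemma cauchy_formula (f : C -> C) (z : C) (rho : R) :
  analytic f -> Cmod z < rho -> rho < 1 ->
  CRInt (fun t => f (rho * cis t) / (rho * cis t - z) * (rho * (Ci * cis t)))%C 0 (2 * PI)
  = ((2 * PI)%R * (Ci * f z))%C.
Proof.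
intros Hf Hz Hrho.
assert (HPI := PI_RGT_0). assert (Hz0 := Cmod_ge_0 z).
assert (Dz : disk z) by (unfold disk; lra).
match goal with |- ?u = ?v => set (J := u); set (W := v) end.
cut (Cmod (J - W) = 0).
{ intros E; apply Cmod_eq_0 in E.
  replace J with ((J - W) + W)%C by ring; rewrite E; apply Cplus_0_l. }
apply Rle_antisym; [|apply Cmod_ge_0].
apply le_epsilon; intros eta Heta; rewrite Rplus_0_l.
set (e := eta / (2 * PI)).
assert (He : 0 < e) by (apply Rdiv_lt_0_compat; lra).
destruct (proj1 (is_Cderive_eps _ _ _) (analytic_is_Cderive f z Hf Dz) 1 Rlt_0_1)
  as [d [Hd0 Hd]].
set (k := Cmod (C_derive f z) + 1).
assert (Hk : 1 <= k) by (generalize (Cmod_ge_0 (C_derive f z)); unfold k; lra).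
set (eps := Rmin (rho - Cmod z) (Rmin (d / 2) (e / k))).
assert (Heps : 0 < eps).
{ repeat apply Rmin_pos; try lra. apply Rdiv_lt_0_compat; lra. }
assert (Heps1 : eps <= rho - Cmod z) by apply Rmin_l.
assert (Heps2 : eps <= d / 2).
{ eapply Rle_trans; [apply Rmin_r|apply Rmin_l]. }
assert (Heps3 : eps <= e / k).
{ eapply Rle_trans; [apply Rmin_r|apply Rmin_r]. }
unfold J; rewrite (cauchy_circles f z rho eps) by (trivial; lra).
replace W with ((2 * PI)%R * (Ci * f z) - 0%R * (Ci * f z))%C by (unfold W; ring).
replace eta with ((2 * PI - 0) * e) by (unfold e; field; lra).
assert (Hnear : forall t, Cmod (z + eps * cis t - z) = eps).
{ intros t; replace (z + eps * cis t - z)%C with (eps * cis t)%C by ring.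
  rewrite Cmod_mult, Cmod_cis, Cmod_R, Rabs_pos_eq; lra. }
assert (Hvel : forall t, is_velocity (fun t => z + eps * cis t)%C t (eps * (Ci * cis t))%C).
{ intros t; apply is_velocity_components; unfold Re, Im, cis; simpl; split;
      auto_derive; trivial; ring. }
assert (Hdisk : forall t, disk (z + eps * cis t)).
{ intros t; unfold disk; refine (Rle_lt_trans _ _ _ (Cmod_triangle _ _) _).
  rewrite Cmod_mult, Cmod_cis, Cmod_R, Rabs_pos_eq; lra. }
assert (Hred : forall t, (f (z + eps * cis t) / (z + eps * cis t - z) * (eps * (Ci * cis t)))%C
   = (f (z + eps * cis t) * Ci)%C).
{ intros t; field; apply Cmod_pos_neq; rewrite Hnear; exact Heps. }
apply CRInt_approx with
  (psi := fun t => (Ci * f z)%C) (Psi := fun t : R => (t * (Ci * f z))%C); [lra| | | |].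
- intros t _.
  apply continuous_ext with (fun t => f (z + eps * cis t) * Ci)%C.
  { intros u; now rewrite Hred. }
  apply Ccontinuous_mult; [|apply continuous_const].
  eapply is_velocity_continuous, is_velocity_comp; [|apply Hvel].
  apply (analytic_is_Cderive f (z + eps * cis t)%C Hf (Hdisk t)).
- intros t _; apply is_velocity_components; unfold Re, Im; simpl; split;
    auto_derive; trivial; ring.
- intros t _; apply continuous_const.
- intros t _; rewrite Hred.
  replace (f (z + eps * cis t) * Ci - Ci * f z)%C with
    ((f (z + eps * cis t) - f z) * Ci)%C by ring.
  rewrite Cmod_mult, Cmod_Ci, Rmult_1_r.
  replace (f (z + eps * cis t) - f z)%C with
    ((f (z + eps * cis t) - f z - (z + eps * cis t - z) * C_derive f z)
     + (z + eps * cis t - z) * C_derive f z)%C by ring.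
  refine (Rle_trans _ _ _ (Cmod_triangle _ _) _).
  assert (Hd' := Hd (z + eps * cis t)%C); rewrite Hnear in Hd'.
  rewrite (Cmod_mult (z + eps * cis t - z)), Hnear.
  apply Rle_trans with (eps * k); [unfold k; specialize (Hd' ltac:(lra)); lra|].
  replace e with (e / k * k) by (field; lra).
  apply Rmult_le_compat_r; lra.
Qed.

(** * The derivative of an analytic function is analytic *)

Lemma is_CRInt_Cmult (k : C) (c : R -> C) (a b : R) (l : C) :
  @is_RInt C_R_NormedModule c a b l ->
  @is_RInt C_R_NormedModule (fun t => k * c t)%C a b (k * l)%C.
Proof.
intros H.
assert (H1 := is_RInt_fct_extend_fst (U:=R_NormedModule) (V:=R_NormedModule) c a b l H).
assert (H2 := is_RInt_fct_extend_snd (U:=R_NormedModule) (V:=R_NormedModule) c a b l H).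
apply (is_RInt_fct_extend_pair (U:=R_NormedModule) (V:=R_NormedModule)).
- apply (is_RInt_minus (V:=R_NormedModule)); now apply (is_RInt_scal (V:=R_NormedModule)).
- apply (is_RInt_plus (V:=R_NormedModule)); now apply (is_RInt_scal (V:=R_NormedModule)).
Qed.

Lemma is_Cderive_local (f g : C -> C) (z l : C) (r : R) :
  0 < r -> (forall w, Cmod (w - z) < r -> f w = g w) ->
  is_Cderive f z l -> is_Cderive g z l.
Proof.
intros Hr E; rewrite !is_Cderive_eps; intros Hf eps Heps.
destruct (Hf eps Heps) as [d [Hd0 Hd]].
exists (Rmin r d); split; [now apply Rmin_pos|].
intros w Hw.
rewrite <- (E w) by (eapply Rlt_le_trans; [exact Hw|apply Rmin_l]).
rewrite <- (E z).
- apply Hd; eapply Rlt_le_trans; [exact Hw|apply Rmin_r].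
- replace (z - z)%C with (RtoC 0) by ring; now rewrite Cmod_0.
Qed.

(** A second-order bound that is uniform in [t] passes under the integral. *)
Lemma is_Cderive_CRInt_param (k : C -> R -> C) (k1 : R -> C) (z : C) (a b K r : R) :
  a <= b -> 0 < r ->
  (forall w t, Cmod (w - z) < r -> a <= t <= b -> Ccontinuous (k w) t) ->
  (forall t, a <= t <= b -> Ccontinuous k1 t) ->
  (forall w t, Cmod (w - z) < r -> a <= t <= b ->
     Cmod (k w t - k z t - (w - z) * k1 t) <= K * Cmod (w - z) ^ 2) ->
  is_Cderive (fun w => CRInt (k w) a b) z (CRInt k1 a b).
Proof.
intros Hab Hr Hk Hk1 HK.
apply is_Cderive_quadratic with (K := (b - a) * K) (r := r); [exact Hr|].
intros w Hw.
assert (Hz : Cmod (z - z) < r).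
{ replace (z - z)%C with (RtoC 0) by ring; now rewrite Cmod_0. }
rewrite Cmod_norm, Rmult_assoc.
apply (norm_RInt_le_const (V:=C_R_NormedModule)
  (fun t => (k w t - k z t - (w - z) * k1 t)%C)); [exact Hab| |].
- intros t Ht; rewrite <- Cmod_norm; now apply HK.
- apply (is_RInt_minus (V:=C_R_NormedModule) (fun t => k w t - k z t)%C
    (fun t => (w - z) * k1 t)%C).
  + apply (is_RInt_minus (V:=C_R_NormedModule) (k w) (k z));
    apply (RInt_correct (V:=C_R_CompleteNormedModule)), ex_CRInt_of_continuous;
    trivial; intros t Ht; now apply Hk.
  + apply is_CRInt_Cmult.
    apply (RInt_correct (V:=C_R_CompleteNormedModule)), ex_CRInt_of_continuous; trivial.
Qed.

Lemma continuous_Cmod (z : C) : @continuous C_UniformSpace R_UniformSpace Cmod z.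
Proof.
apply (continuous_ext (fun x : C_R_NormedModule => norm x)).
{ intros x; symmetry; apply Cmod_norm. }
exact (filterlim_norm (V := C_R_NormedModule) z).
Qed.

Lemma Ccontinuous_bounded (c : R -> C) (a b : R) :
  a <= b -> (forall t, a <= t <= b -> Ccontinuous c t) ->
  exists M, 0 <= M /\ forall t, a <= t <= b -> Cmod (c t) <= M.
Proof.
intros Hab Hc.
destruct (continuity_ab_maj (fun t => Cmod (c t)) a b Hab) as [x [Hx _]].
- intros t Ht; apply continuity_pt_filterlim.
  apply (continuous_comp c Cmod); [now apply Hc|].
  apply continuous_Cmod.
- exists (Cmod (c x)); split; [apply Cmod_ge_0|exact Hx].
Qed.

Lemma Ccontinuous_div (c d : R -> C) (t : R) :
  Ccontinuous c t -> Ccontinuous d t -> d t <> 0%C ->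
  Ccontinuous (fun u => c u / d u)%C t.
Proof.
intros Hc Hd H0; apply Ccontinuous_mult; [exact Hc|].
revert Hd; rewrite !Ccontinuous_components; intros [d1 d2].
assert (N : Re (d t) ^ 2 + Im (d t) ^ 2 <> 0).
{ intros E; rewrite <- Cmod2_alt in E; apply H0, Cmod_eq_0.
  apply Rsqr_0_uniq; unfold Rsqr; lra. }
assert (Hinv : continuous (fun u => / (Re (d u) ^ 2 + Im (d u) ^ 2)) t).
{ apply (continuous_comp (fun u => Re (d u) ^ 2 + Im (d u) ^ 2) Rinv).
  - apply (continuous_plus (V:=R_NormedModule)).
    + apply (continuous_mult (K:=R_AbsRing) (fun y => Re (d y))); [exact d1|].
      apply (continuous_mult (K:=R_AbsRing) (fun y => Re (d y))); [exact d1|apply continuous_const].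
    + apply (continuous_mult (K:=R_AbsRing) (fun y => Im (d y))); [exact d2|].
      apply (continuous_mult (K:=R_AbsRing) (fun y => Im (d y))); [exact d2|apply continuous_const].
  - apply continuity_pt_filterlim; apply continuity_pt_inv; [|exact N].
    apply continuity_pt_id. }
split.
- apply (continuous_mult (K:=R_AbsRing) (fun y => Re (d y)) _ t d1 Hinv).
- apply (continuous_mult (K:=R_AbsRing) (fun y => - Im (d y))); [|exact Hinv].
  now apply (continuous_opp (V:=R_NormedModule)).
Qed.

Lemma analytic_velocity (f : C -> C) (c : R -> C) (t : R) (v : C) :
  analytic f -> disk (c t) -> is_velocity c t v ->
  is_velocity (fun u => f (c u)) t (C_derive f (c t) * v)%C.
Proof.
intros Hf Hd Hc; apply is_velocity_comp; [|exact Hc].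
now apply analytic_is_Cderive.
Qed.

Lemma Cmod_div_le (x y : C) (B e : R) :
  0 < e -> Cmod x <= B -> e <= Cmod y -> Cmod (x / y) <= B / e.
Proof.
intros He Hx Hy.
rewrite Cmod_div by (apply Cmod_pos_neq; lra).
apply Rmult_le_compat; [apply Cmod_ge_0| |exact Hx|].
- left; apply Rinv_0_lt_compat; lra.
- apply Rinv_le_contravar; assumption.
Qed.

(** The kernel stays away from its pole for [w] within half the distance to the circle. *)
Lemma circle_distance (rho t : R) (z w : C) :
  Cmod z < rho -> Cmod (w - z) < (rho - Cmod z) / 2 ->
  (rho - Cmod z) / 2 <= Cmod (rho * cis t - w).
Proof.
intros Hz Hw.
refine (Rle_trans _ _ _ _ (Cmod_triangle_sub _ _)).
rewrite Cmod_mult, Cmod_cis, Cmod_R, Rabs_pos_eq.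
- generalize (Cmod_triangle_sub w z); lra.
- generalize (Cmod_ge_0 z); lra.
Qed.

Lemma Ccontinuous_circle_sub (rho t : R) (w : C) :
  Ccontinuous (fun t => rho * cis t - w)%C t.
Proof.
eapply is_velocity_continuous with (v := (rho * (Ci * cis t))%C).
apply is_velocity_components; unfold Re, Im, cis; simpl; split;
      auto_derive; trivial; ring.
Qed.

Definition cauchy_transform (W : R -> C) (rho : R) (n : nat) (z : C) : C :=
  CRInt (fun t => W t / (rho * cis t - z) ^ n)%C 0 (2 * PI).

Lemma Ccontinuous_cauchy_kernel (W : R -> C) (rho t : R) (n : nat) (w : C) :
  Ccontinuous W t -> (rho * cis t - w <> 0)%C ->
  Ccontinuous (fun t => W t / (rho * cis t - w) ^ n)%C t.
Proof.
intros HW H0; apply Ccontinuous_div; [exact HW| |now apply Cpow_nz].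
induction n as [|n IH]; [apply continuous_const|].
apply (Ccontinuous_mult (fun t => rho * cis t - w)%C); [apply Ccontinuous_circle_sub|exact IH].
Qed.

Lemma cauchy_transform_derive_1 (W : R -> C) (rho : R) (z : C) :
  (forall t, 0 <= t <= 2 * PI -> Ccontinuous W t) -> Cmod z < rho ->
  is_Cderive (cauchy_transform W rho 1) z (cauchy_transform W rho 2 z).
Proof.
intros HW Hz.
assert (HPI := PI_RGT_0).
destruct (Ccontinuous_bounded W 0 (2 * PI)) as [M [HM0 HM]]; [lra|exact HW|].
set (e := (rho - Cmod z) / 2). assert (He : 0 < e) by (unfold e; lra).
assert (Hnz : forall w t, Cmod (w - z) < e -> (rho * cis t - w <> 0)%C).
{ intros w t Hw; apply Cmod_pos_neq, Rlt_le_trans with e; [exact He|].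
  now apply circle_distance. }
assert (Hzz : Cmod (z - z) < e).
{ replace (z - z)%C with (RtoC 0) by ring; now rewrite Cmod_0. }
apply (is_Cderive_CRInt_param (fun w t => W t / (rho * cis t - w) ^ 1)%C
   (fun t => W t / (rho * cis t - z) ^ 2)%C) with (K := M / e ^ 3) (r := e); trivial; try lra.
- intros w t Hw Ht; apply Ccontinuous_cauchy_kernel; auto.
- intros t Ht; apply Ccontinuous_cauchy_kernel; auto.
- intros w t Hw Ht.
  replace (W t / (rho * cis t - w) ^ 1 - W t / (rho * cis t - z) ^ 1 -
           (w - z) * (W t / (rho * cis t - z) ^ 2))%C with
    ((W t * (w - z) ^ 2) / ((rho * cis t - w) * (rho * cis t - z) ^ 2))%C
    by (field; auto).
  replace (M / e ^ 3 * Cmod (w - z) ^ 2) with ((M * Cmod (w - z) ^ 2) / e ^ 3) by (field; lra).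
  apply Cmod_div_le; [now apply pow_lt| |].
  + rewrite Cmod_mult, Cmod_pow; apply Rmult_le_compat_r; [apply pow2_ge_0|now apply HM].
  + rewrite Cmod_mult, Cmod_pow; simpl (e ^ 3); simpl (_ ^ 2).
    assert (H1 := circle_distance rho t z w Hz Hw).
    assert (H2 := circle_distance rho t z z Hz Hzz). fold e in H1, H2.
    repeat apply Rmult_le_compat; nra.
Qed.

(** The remainder is [h^2 (3 A - 2 h) / (A^3 (A - h)^2)] with [A = rho e^{it} - z] and
    [h = w - z], where [|A| <= 2 rho] and [|h| <= rho]. *)
Lemma cauchy_transform_derive_2 (W : R -> C) (rho : R) (z : C) :
  (forall t, 0 <= t <= 2 * PI -> Ccontinuous W t) -> Cmod z < rho ->
  is_Cderive (cauchy_transform W rho 2) z (cauchy_transform (fun t => 2 * W t)%C rho 3 z).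
Proof.
intros HW Hz.
assert (HPI := PI_RGT_0). assert (Hz0 := Cmod_ge_0 z).
destruct (Ccontinuous_bounded W 0 (2 * PI)) as [M [HM0 HM]]; [lra|exact HW|].
set (e := (rho - Cmod z) / 2). assert (He : 0 < e) by (unfold e; lra).
assert (Hnz : forall w t, Cmod (w - z) < e -> (rho * cis t - w <> 0)%C).
{ intros w t Hw; apply Cmod_pos_neq, Rlt_le_trans with e; [exact He|].
  now apply circle_distance. }
assert (Hzz : Cmod (z - z) < e).
{ replace (z - z)%C with (RtoC 0) by ring; now rewrite Cmod_0. }
apply (is_Cderive_CRInt_param (fun w t => W t / (rho * cis t - w) ^ 2)%C
   (fun t => 2 * W t / (rho * cis t - z) ^ 3)%C) with (K := M * (8 * rho) / e ^ 5) (r := e);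
  trivial; try lra.
- intros w t Hw Ht; apply Ccontinuous_cauchy_kernel; auto.
- intros t Ht; apply (Ccontinuous_cauchy_kernel (fun t => 2 * W t)%C); auto.
  apply (Ccontinuous_mult (fun _ => RtoC 2)); [apply continuous_const|auto].
- intros w t Hw Ht.
  replace (W t / (rho * cis t - w) ^ 2 - W t / (rho * cis t - z) ^ 2 -
           (w - z) * (2 * W t / (rho * cis t - z) ^ 3))%C with
    ((W t * (3 * (rho * cis t - z) - 2 * (w - z)) * (w - z) ^ 2)
      / ((rho * cis t - w) ^ 2 * (rho * cis t - z) ^ 3))%C
    by (field; auto).
  replace (M * (8 * rho) / e ^ 5 * Cmod (w - z) ^ 2) with
    ((M * (8 * rho) * Cmod (w - z) ^ 2) / e ^ 5) by (field; lra).
  apply Cmod_div_le; [now apply pow_lt| |].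
  + rewrite Cmod_mult, Cmod_pow; apply Rmult_le_compat_r; [apply pow2_ge_0|].
    rewrite Cmod_mult; apply Rmult_le_compat; try apply Cmod_ge_0; [now apply HM|].
    assert (H1 : Cmod (3 * (rho * cis t - z)) <= 6 * rho).
    { rewrite Cmod_mult, Cmod_R, Rabs_pos_eq by lra.
      assert (H2 := Cmod_triangle (rho * cis t) (- z)).
      rewrite Cmod_opp, Cmod_mult, Cmod_cis, Cmod_R, Rabs_pos_eq in H2 by lra.
      unfold Cminus; lra. }
    assert (H2 : Cmod (- (2 * (w - z))) <= 2 * rho).
    { rewrite Cmod_opp, Cmod_mult, Cmod_R, Rabs_pos_eq by lra. unfold e in Hw; lra. }
    refine (Rle_trans _ _ _ (Cmod_triangle _ _) _); lra.
  + rewrite Cmod_mult, !Cmod_pow; replace (e ^ 5) with (e ^ 2 * e ^ 3) by ring.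
    assert (H1 := circle_distance rho t z w Hz Hw).
    assert (H2 := circle_distance rho t z z Hz Hzz). fold e in H1, H2.
    apply Rmult_le_compat; try (apply pow_le; lra); apply pow_incr; lra.
Qed.

Lemma Ccontinuous_analytic_circle (f : C -> C) (rho t : R) :
  analytic f -> 0 <= rho < 1 -> Ccontinuous (fun t => f (rho * cis t))%C t.
Proof.
intros Hf Hrho.
eapply is_velocity_continuous, analytic_velocity with (v := (rho * (Ci * cis t))%C);
  [exact Hf| |].
- unfold disk; rewrite Cmod_mult, Cmod_cis, Cmod_R, Rabs_pos_eq; lra.
- apply is_velocity_components; unfold Re, Im, cis; simpl; split;
      auto_derive; trivial; ring.
Qed.

Lemma Ccontinuous_cauchy_weight (f : C -> C) (rho t : R) :
  analytic f -> 0 <= rho < 1 ->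
  Ccontinuous (fun t => f (rho * cis t) * (rho * (Ci * cis t)))%C t.
Proof.
intros Hf Hrho.
apply Ccontinuous_mult; [now apply Ccontinuous_analytic_circle|].
apply (Ccontinuous_mult (fun _ => RtoC rho)); [apply continuous_const|].
apply (Ccontinuous_mult (fun _ => Ci)); [apply continuous_const|apply continuous_cis].
Qed.

Lemma cauchy_formula_transform (f : C -> C) (z : C) (rho : R) :
  analytic f -> Cmod z < rho -> rho < 1 ->
  f z = (/ ((2 * PI)%R * Ci) *
     cauchy_transform (fun t => f (rho * cis t) * (rho * (Ci * cis t)))%C rho 1 z)%C.
Proof.
intros Hf Hz Hrho.
transitivity (/ ((2 * PI)%R * Ci) * ((2 * PI)%R * (Ci * f z)))%C.
- assert (HPI := PI_RGT_0).
  field; split; apply Cmod_pos_neq; rewrite ?Cmod_Ci, ?Cmod_R, ?Rabs_pos_eq; lra.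
- f_equal; rewrite <- (cauchy_formula f z rho Hf Hz Hrho).
  apply (RInt_ext (V := C_R_CompleteNormedModule)); intros t _.
  unfold Cdiv; change ((rho * cis t - z) ^ 1)%C with ((rho * cis t - z) * 1)%C.
  match goal with |- @eq _ ?a ?b => change (@eq C a b) end.
  rewrite Cmult_1_r; ring.
Qed.

(** Inside a circle of radius [rho < 1], Cauchy's formula writes [f] as a Cauchy transform,
    which is twice differentiable. *)
Theorem analytic_C_derive (f : C -> C) : analytic f -> analytic (C_derive f).
Proof.
intros Hf z Hz; unfold disk in Hz.
assert (Hz0 := Cmod_ge_0 z).
set (rho := (1 + Cmod z) / 2).
assert (Hrho : Cmod z < rho < 1) by (unfold rho; lra).
set (W := fun t => (f (rho * cis t) * (rho * (Ci * cis t)))%C).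
set (k := (/ ((2 * PI)%R * Ci))%C).
assert (HW : forall t, 0 <= t <= 2 * PI -> Ccontinuous W t).
{ intros t _; apply Ccontinuous_cauchy_weight; [exact Hf|lra]. }
assert (Hin : forall w, Cmod (w - z) < rho - Cmod z -> Cmod w < rho).
{ intros w Hw; generalize (Cmod_triangle_sub w z); lra. }
exists (0 * cauchy_transform W rho 2 z + k * cauchy_transform (fun t => 2 * W t)%C rho 3 z)%C.
apply (is_Cderive_local (fun w => k * cauchy_transform W rho 2 w)%C) with
  (r := rho - Cmod z); [lra| |].
- intros w Hw; apply Hin in Hw; symmetry; apply is_C_derive_unique.
  apply (is_Cderive_local (fun w => k * cauchy_transform W rho 1 w)%C) with
    (r := rho - Cmod w); [lra| |].
  + intros v Hv; symmetry; apply cauchy_formula_transform; [exact Hf| |lra].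
    generalize (Cmod_triangle_sub v w); lra.
  + replace (k * cauchy_transform W rho 2 w)%C with
      (0 * cauchy_transform W rho 1 w + k * cauchy_transform W rho 2 w)%C by ring.
    apply (is_Cderive_mult (fun _ => k)); [apply is_Cderive_const|].
    now apply cauchy_transform_derive_1.
- apply (is_Cderive_mult (fun _ => k)); [apply is_Cderive_const|].
  now apply cauchy_transform_derive_2.
Qed.

(** Cauchy's formula also replaces a compactness argument on closed disks. *)
Lemma analytic_bounded (f : C -> C) (r : R) :
  analytic f -> 0 <= r < 1 ->
  exists M, forall z, Cmod z <= r -> Cmod (f z) <= M.
Proof.
intros Hf Hr.
assert (HPI := PI_RGT_0).
set (rho := (1 + r) / 2). assert (Hrho : r < rho < 1) by (unfold rho; lra).
set (W := fun t => (f (rho * cis t) * (rho * (Ci * cis t)))%C).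
assert (HW : forall t, 0 <= t <= 2 * PI -> Ccontinuous W t).
{ intros t _; apply Ccontinuous_cauchy_weight; [exact Hf|lra]. }
destruct (Ccontinuous_bounded W 0 (2 * PI)) as [M [HM0 HM]]; [lra|exact HW|].
exists (Cmod (/ ((2 * PI)%R * Ci)) * ((2 * PI - 0) * (M / (rho - r)))).
intros z Hz.
assert (Hd : forall t, rho - r <= Cmod (rho * cis t - z)).
{ intros t; refine (Rle_trans _ _ _ _ (Cmod_triangle_sub _ _)).
  rewrite Cmod_mult, Cmod_cis, Cmod_R, Rabs_pos_eq; lra. }
rewrite (cauchy_formula_transform f z rho) by (trivial; lra).
rewrite Cmod_mult; apply Rmult_le_compat_l; [apply Cmod_ge_0|].
fold W; unfold cauchy_transform; rewrite Cmod_norm.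
apply (norm_RInt_le_const (V:=C_R_NormedModule) (fun t => W t / (rho * cis t - z) ^ 1)%C);
  [lra| |].
- intros t Ht; rewrite <- Cmod_norm; apply Cmod_div_le; [lra|now apply HM|].
  rewrite Cmod_pow, pow_1; apply Hd.
- apply (RInt_correct (V:=C_R_CompleteNormedModule)), ex_CRInt_of_continuous; [lra|].
  intros t Ht; apply Ccontinuous_cauchy_kernel; [now apply HW|].
  apply Cmod_pos_neq; specialize (Hd t); lra.
Qed.

(** * Logarithmic polar coordinates *)

(** The point [e^{s + it}].  In these coordinates both partial derivatives are multiplication
    by [z] or [iz], so Laplacians have no lower-order terms. *)
Definition polar (s t : R) : C := (exp s * cis t)%C.

Lemma Cmod_polar (s t : R) : Cmod (polar s t) = exp s.
Proof.
unfold polar; rewrite Cmod_mult, Cmod_cis, Cmod_R, Rabs_pos_eq; [ring|left; apply exp_pos].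
Qed.

Lemma disk_polar (s t : R) : s < 0 -> disk (polar s t).
Proof. intros Hs; unfold disk; rewrite Cmod_polar, <- exp_0; now apply exp_increasing. Qed.

Lemma polar_2PI (s : R) : polar s (2 * PI) = polar s 0.
Proof. unfold polar; now rewrite cis_2PI. Qed.

Lemma is_velocity_polar_s (s t : R) : is_velocity (fun s => polar s t) s (polar s t).
Proof.
apply is_velocity_components; unfold polar, Re, Im, cis; simpl; split;
  auto_derive; trivial; ring.
Qed.

Lemma is_velocity_polar_t (s t : R) : is_velocity (polar s) t (Ci * polar s t)%C.
Proof.
apply is_velocity_components; unfold polar, Re, Im, cis; simpl; split;
  auto_derive; trivial; ring.
Qed.

Lemma Ccontinuous_polar (q : R * R) : Ccontinuous (fun q : R * R => polar (fst q) (snd q)) q.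
Proof.
assert (H1 : continuous (fun q : R * R => exp (fst q)) q).
{ apply (continuous_comp fst exp); [apply continuous_fst|apply continuous_exp]. }
assert (H2 : continuous (fun q : R * R => cis (snd q)) q).
{ apply (continuous_comp snd cis); [apply continuous_snd|apply continuous_cis]. }
apply (Ccontinuous_mult (fun q : R * R => RtoC (exp (fst q)))); [|exact H2].
apply Ccontinuous_components; split; [exact H1|apply continuous_const].
Qed.

Lemma analytic_continuous (f : C -> C) (z : C) :
  analytic f -> disk z -> Ccontinuous f z.
Proof.
intros Hf Hz P HP.
assert (H := ex_derive_continuous (K := C_AbsRing) (V := C_NormedModule) f z (Hf z Hz) P HP).
exact (proj2 (locally_C z _) H).
Qed.

Lemma Ccontinuous_analytic_polar (f : C -> C) (s t : R) :
  analytic f -> s < 0 ->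
  Ccontinuous (fun q : R * R => f (polar (fst q) (snd q))) (s, t).
Proof.
intros Hf Hs.
apply (continuous_comp (fun q : R * R => polar (fst q) (snd q)) f).
- apply Ccontinuous_polar.
- apply analytic_continuous; [exact Hf|now apply disk_polar].
Qed.

Lemma continuous_slice {V : UniformSpace} (F : R -> R -> V) (s t : R) :
  continuous (fun q : R * R => F (fst q) (snd q)) (s, t) -> continuous (F s) t.
Proof.
intros H.
apply (continuous_comp (fun t : R => (s, t)) (fun q : R * R => F (fst q) (snd q))); [|exact H].
intros P [d Hd]; exists d; intros y Hy; apply Hd; split; [apply ball_center|exact Hy].
Qed.

Lemma continuous_slice_l {V : UniformSpace} (F : R -> R -> V) (s t : R) :
  continuous (fun q : R * R => F (fst q) (snd q)) (s, t) -> continuous (fun s => F s t) s.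
Proof.
intros H.
apply (continuous_comp (fun s : R => (s, t)) (fun q : R * R => F (fst q) (snd q))); [|exact H].
intros P [d Hd]; exists d; intros y Hy; apply Hd; split; [exact Hy|apply ball_center].
Qed.

(** The margin [r] around [[a, b]] is there because joint continuity at an end point looks
    at [t] on both sides of it. *)
Lemma is_derive_RInt_continuous_param (f df : R -> R -> R) (a b x r : R) :
  a <= b -> 0 < r ->
  (forall y t, Rabs (y - x) < r -> a - r < t < b + r ->
     is_derive (fun y => f y t) y (df y t) /\ continuous (f y) t) ->
  (forall t, a <= t <= b -> continuous (fun q : R * R => df (fst q) (snd q)) (x, t)) ->
  is_derive (fun y => RInt (f y) a b) x (RInt (df x) a b).
Proof.
intros Hab Hr Hf Hdf.
assert (Hx : Rabs (x - x) < r) by (rewrite Rminus_diag, Rabs_R0; exact Hr).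
replace (RInt (df x) a b) with (RInt (fun t => Derive (fun y => f y t) x) a b).
2:{ apply RInt_ext; intros t; rewrite Rmin_left, Rmax_right by exact Hab; intros Ht.
    apply is_derive_unique, Hf; [exact Hx|lra]. }
apply is_derive_RInt_param; rewrite ?Rmin_left, ?Rmax_right by exact Hab.
- exists (mkposreal r Hr); intros y Hy t Ht.
  exists (df y t); apply Hf; [exact Hy|lra].
- intros t Ht.
  apply continuity_2d_pt_ext_loc with df.
  2:{ apply continuity_2d_pt_filterlim; now apply Hdf. }
  exists (mkposreal r Hr); intros u v Hu Hv; symmetry.
  apply is_derive_unique, Hf; [exact Hu|].
  apply Rabs_lt_between in Hv; simpl in Hv; lra.
- exists (mkposreal r Hr); intros y Hy.
  apply (ex_RInt_continuous (V := R_CompleteNormedModule)).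
  rewrite Rmin_left, Rmax_right by exact Hab; intros t Ht.
  apply Hf; [exact Hy|lra].
Qed.

(** The logarithmic derivative of [|c|] is [Re (c' / c)]. *)
Lemma is_derive_Rpower_Cmod (c : R -> C) (t p : R) (v : C) :
  is_velocity c t v -> c t <> 0%C ->
  is_derive (fun u => Rpower (Cmod (c u)) p) t
    (p * Rpower (Cmod (c t)) p * Re (v / c t)%C).
Proof.
rewrite is_velocity_components; intros [H1 H2] H0.
assert (N : 0 < Re (c t) ^ 2 + Im (c t) ^ 2).
{ rewrite <- Cmod2_alt; apply pow_lt; now apply Cmod_gt_0. }
assert (G : forall X Y : R -> R, forall x y : R, is_derive X t x -> is_derive Y t y ->
  0 < X t ^ 2 + Y t ^ 2 ->
  is_derive (fun u => exp (p * ln (sqrt (X u ^ 2 + Y u ^ 2)))) t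
   (p * exp (p * ln (sqrt (X t ^ 2 + Y t ^ 2))) *
      ((x * X t + y * Y t) / (X t ^ 2 + Y t ^ 2)))).
{ intros X Y x y HX HY HN.
  assert (HS := sqrt_lt_R0 _ HN). assert (HSS := sqrt_sqrt _ (Rlt_le _ _ HN)).
  auto_derive.
  - repeat split; try (eexists; eassumption); rewrite ?Rmult_1_r.
    + simpl in HN; rewrite !Rmult_1_r in HN; exact HN.
    + simpl in HS; rewrite !Rmult_1_r in HS; exact HS.
  - change (Derive (fun u => X u) t) with (Derive X t).
    change (Derive (fun u => Y u) t) with (Derive Y t).
    rewrite (is_derive_unique _ _ _ HX), (is_derive_unique _ _ _ HY).
    replace (X t * (X t * 1) + Y t * (Y t * 1)) with (X t ^ 2 + Y t ^ 2) by ring.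
    set (S := sqrt (X t ^ 2 + Y t ^ 2)) in *.
    rewrite <- HSS; field; lra. }
specialize (G _ _ _ _ H1 H2 N).
replace (Re (v / c t)%C) with
  ((Re v * Re (c t) + Im v * Im (c t)) / (Re (c t) ^ 2 + Im (c t) ^ 2)).
- exact G.
- unfold Re, Im in *; simpl in *; field; lra.
Qed.

(** * The Laplacian of [|phi|^p] and its circular means *)

Definition logder (phi : C -> C) (z : C) : C := (z * C_derive phi z / phi z)%C.

Definition modpow (p : R) (phi : C -> C) (s t : R) : R := Rpower (Cmod (phi (polar s t))) p.

Definition nonvanishing (phi : C -> C) : Prop := forall z, disk z -> phi z <> 0%C.

Lemma analytic_logder (phi : C -> C) :
  analytic phi -> nonvanishing phi -> analytic (logder phi).
Proof.
intros Ha H0 z Hz; eexists.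
apply (is_Cderive_div (fun z => z * C_derive phi z)%C phi).
- apply (is_Cderive_mult (fun z => z)); [apply is_Cderive_id|].
  now apply analytic_is_Cderive; [apply analytic_C_derive|].
- now apply analytic_is_Cderive.
- now apply H0.
Qed.

Lemma modpow_derive_s (p : R) (phi : C -> C) (s t : R) :
  analytic phi -> nonvanishing phi -> s < 0 ->
  is_derive (fun s => modpow p phi s t) s (p * modpow p phi s t * Re (logder phi (polar s t))).
Proof.
intros Ha H0 Hs; assert (Hd := disk_polar s t Hs).
replace (logder phi (polar s t)) with
  (C_derive phi (polar s t) * polar s t / phi (polar s t))%C
  by (unfold logder; now rewrite (Cmult_comm (polar s t))).
apply (is_derive_Rpower_Cmod (fun s => phi (polar s t))); [|now apply H0].
apply (analytic_velocity phi (fun s => polar s t)); [exact Ha|exact Hd|].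
apply is_velocity_polar_s.
Qed.

Lemma modpow_derive_t (p : R) (phi : C -> C) (s t : R) :
  analytic phi -> nonvanishing phi -> s < 0 ->
  is_derive (modpow p phi s) t (p * modpow p phi s t * - Im (logder phi (polar s t))).
Proof.
intros Ha H0 Hs; assert (Hd := disk_polar s t Hs).
replace (- Im (logder phi (polar s t))) with
  (Re (C_derive phi (polar s t) * (Ci * polar s t) / phi (polar s t))%C).
2:{ transitivity (Re (Ci * logder phi (polar s t)))%C; [|unfold Re, Im; simpl; ring].
    unfold logder; f_equal; unfold Cdiv; ring. }
apply (is_derive_Rpower_Cmod (fun t => phi (polar s t))); [|now apply H0].
apply (analytic_velocity phi (fun t => polar s t)); [exact Ha|exact Hd|].
apply is_velocity_polar_t.
Qed.

(** The second derivatives of [|phi|^p] in [s] and in [t].  The terms with the derivative of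
    [Q = logder phi] are opposite, since [Q] is analytic. *)
Definition modpow_ss (p : R) (phi : C -> C) (s t : R) : R :=
  p * modpow p phi s t * (p * Re (logder phi (polar s t)) ^ 2
     + Re (polar s t * C_derive (logder phi) (polar s t))%C).

Definition modpow_tt (p : R) (phi : C -> C) (s t : R) : R :=
  p * modpow p phi s t * (p * Im (logder phi (polar s t)) ^ 2
     - Re (polar s t * C_derive (logder phi) (polar s t))%C).

Lemma modpow_derive_ss (p : R) (phi : C -> C) (s t : R) :
  analytic phi -> nonvanishing phi -> s < 0 ->
  is_derive (fun s => p * modpow p phi s t * Re (logder phi (polar s t))) s
    (modpow_ss p phi s t).
Proof.
intros Ha H0 Hs; assert (Hd := disk_polar s t Hs).
assert (HQ := analytic_logder phi Ha H0).
destruct (proj1 (is_velocity_components _ _ _)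
  (analytic_velocity _ (fun s => polar s t) s _ HQ Hd (is_velocity_polar_s s t))) as [K _].
assert (Hu := is_derive_scal _ _ p _ (modpow_derive_s p phi s t Ha H0 Hs)).
replace (modpow_ss p phi s t) with
  (p * (p * modpow p phi s t * Re (logder phi (polar s t))) * Re (logder phi (polar s t))
   + p * modpow p phi s t * Re (C_derive (logder phi) (polar s t) * polar s t)%C).
- apply (is_derive_mult (K := R_AbsRing) (fun s => p * modpow p phi s t)
    (fun s => Re (logder phi (polar s t)))); [exact Hu|exact K|exact Rmult_comm].
- unfold modpow_ss; rewrite (Cmult_comm (polar s t)); ring.
Qed.

Lemma modpow_derive_tt (p : R) (phi : C -> C) (s t : R) :
  analytic phi -> nonvanishing phi -> s < 0 ->
  is_derive (fun t => p * modpow p phi s t * - Im (logder phi (polar s t))) t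
    (modpow_tt p phi s t).
Proof.
intros Ha H0 Hs; assert (Hd := disk_polar s t Hs).
assert (HQ := analytic_logder phi Ha H0).
destruct (proj1 (is_velocity_components _ _ _)
  (analytic_velocity _ (polar s) t _ HQ Hd (is_velocity_polar_t s t))) as [_ K].
assert (Hu := is_derive_scal _ _ p _ (modpow_derive_t p phi s t Ha H0 Hs)).
replace (modpow_tt p phi s t) with
  (p * (p * modpow p phi s t * - Im (logder phi (polar s t))) * - Im (logder phi (polar s t))
   + p * modpow p phi s t * - Im (C_derive (logder phi) (polar s t) * (Ci * polar s t))%C).
- apply (is_derive_mult (K := R_AbsRing) (fun t => p * modpow p phi s t)
    (fun t => - Im (logder phi (polar s t)))); [exact Hu| |exact Rmult_comm].
  now apply (is_derive_opp (V := R_NormedModule) (fun t => Im (logder phi (polar s t)))).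
- unfold modpow_tt.
  replace (Im (C_derive (logder phi) (polar s t) * (Ci * polar s t))%C) with
    (Re (polar s t * C_derive (logder phi) (polar s t))%C)
    by (unfold Re, Im; simpl; ring).
  ring.
Qed.

Lemma modpow_laplacian (p : R) (phi : C -> C) (s t : R) :
  modpow_ss p phi s t + modpow_tt p phi s t
  = p ^ 2 * modpow p phi s t * Cmod (logder phi (polar s t)) ^ 2.
Proof. rewrite Cmod2_alt; unfold modpow_ss, modpow_tt; ring. Qed.

Lemma modpow_pos (p : R) (phi : C -> C) (s t : R) : 0 < modpow p phi s t.
Proof. apply exp_pos. Qed.

Lemma continuous_Rmult {U : UniformSpace} (f g : U -> R) (x : U) :
  continuous f x -> continuous g x -> continuous (fun y => f y * g y) x.
Proof. exact (continuous_mult (K := R_AbsRing) f g x). Qed.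

Lemma continuous_modpow (p : R) (phi : C -> C) (s t : R) :
  analytic phi -> nonvanishing phi -> s < 0 ->
  continuous (fun q : R * R => modpow p phi (fst q) (snd q)) (s, t).
Proof.
intros Ha H0 Hs.
apply (continuous_comp (fun q : R * R => phi (polar (fst q) (snd q)))
  (fun z => Rpower (Cmod z) p)); [now apply Ccontinuous_analytic_polar|].
set (z := phi _).
assert (Hz : 0 < Cmod z) by (apply Cmod_gt_0, H0; now apply disk_polar).
apply (continuous_comp (U := C_UniformSpace) Cmod (fun x => Rpower x p)).
- apply continuous_Cmod.
- apply (ex_derive_continuous (K := R_AbsRing) (V := R_NormedModule)).
  unfold Rpower; auto_derive; exact Hz.
Qed.

Lemma continuous_Re_analytic (k : C -> C) (s t : R) :
  analytic k -> s < 0 ->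
  continuous (fun q : R * R => Re (k (polar (fst q) (snd q)))) (s, t).
Proof.
intros Ha Hs; apply (Ccontinuous_components (fun q : R * R => k (polar (fst q) (snd q)))).
now apply Ccontinuous_analytic_polar.
Qed.

Lemma continuous_Im_analytic (k : C -> C) (s t : R) :
  analytic k -> s < 0 ->
  continuous (fun q : R * R => Im (k (polar (fst q) (snd q)))) (s, t).
Proof.
intros Ha Hs; apply (Ccontinuous_components (fun q : R * R => k (polar (fst q) (snd q)))).
now apply Ccontinuous_analytic_polar.
Qed.

Lemma analytic_id_mult (k : C -> C) : analytic k -> analytic (fun z => z * k z)%C.
Proof.
intros Hk z Hz; eexists; apply (is_Cderive_mult (fun z => z)); [apply is_Cderive_id|].
now apply analytic_is_Cderive.
Qed.

Lemma continuous_modpow_s (p : R) (phi : C -> C) (s t : R) :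
  analytic phi -> nonvanishing phi -> s < 0 ->
  continuous (fun q : R * R => p * modpow p phi (fst q) (snd q)
                * Re (logder phi (polar (fst q) (snd q)))) (s, t).
Proof.
intros Ha H0 Hs.
apply continuous_Rmult.
- apply (continuous_Rmult (fun _ => p)); [apply continuous_const|].
  now apply continuous_modpow.
- apply continuous_Re_analytic; [now apply analytic_logder|exact Hs].
Qed.

Lemma continuous_modpow_t (p : R) (phi : C -> C) (s t : R) :
  analytic phi -> nonvanishing phi -> s < 0 ->
  continuous (fun q : R * R => p * modpow p phi (fst q) (snd q)
                * - Im (logder phi (polar (fst q) (snd q)))) (s, t).
Proof.
intros Ha H0 Hs.
apply continuous_Rmult.
- apply (continuous_Rmult (fun _ => p)); [apply continuous_const|].
  now apply continuous_modpow.
- apply (continuous_opp (V := R_NormedModule)).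
  apply continuous_Im_analytic; [now apply analytic_logder|exact Hs].
Qed.

Lemma continuous_modpow_ss (p : R) (phi : C -> C) (s t : R) :
  analytic phi -> nonvanishing phi -> s < 0 ->
  continuous (fun q : R * R => modpow_ss p phi (fst q) (snd q)) (s, t).
Proof.
intros Ha H0 Hs; assert (HQ := analytic_logder phi Ha H0).
apply continuous_Rmult.
- apply (continuous_Rmult (fun _ => p)); [apply continuous_const|].
  now apply continuous_modpow.
- apply (continuous_plus (V := R_NormedModule)).
  + apply (continuous_Rmult (fun _ => p)); [apply continuous_const|].
    apply continuous_Rmult; [now apply continuous_Re_analytic|].
    apply continuous_Rmult; [now apply continuous_Re_analytic|apply continuous_const].
  + apply (continuous_Re_analytic (fun z => z * C_derive (logder phi) z)%C); [|exact Hs].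
    now apply analytic_id_mult, analytic_C_derive.
Qed.

Lemma continuous_modpow_tt (p : R) (phi : C -> C) (s t : R) :
  analytic phi -> nonvanishing phi -> s < 0 ->
  continuous (fun q : R * R => modpow_tt p phi (fst q) (snd q)) (s, t).
Proof.
intros Ha H0 Hs; assert (HQ := analytic_logder phi Ha H0).
apply continuous_Rmult.
- apply (continuous_Rmult (fun _ => p)); [apply continuous_const|].
  now apply continuous_modpow.
- apply (continuous_minus (V := R_NormedModule)).
  + apply (continuous_Rmult (fun _ => p)); [apply continuous_const|].
    apply continuous_Rmult; [now apply continuous_Im_analytic|].
    apply continuous_Rmult; [now apply continuous_Im_analytic|apply continuous_const].
  + apply (continuous_Re_analytic (fun z => z * C_derive (logder phi) z)%C); [|exact Hs].
    now apply analytic_id_mult, analytic_C_derive.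
Qed.

Lemma ex_RInt_slice (F : R -> R -> R) (s a b : R) :
  a <= b ->
  (forall t, a <= t <= b -> continuous (fun q : R * R => F (fst q) (snd q)) (s, t)) ->
  ex_RInt (F s) a b.
Proof.
intros Hab H; apply (ex_RInt_continuous (V := R_CompleteNormedModule)).
rewrite Rmin_left, Rmax_right by exact Hab; intros t Ht.
now apply continuous_slice, H.
Qed.

Definition mean (p : R) (phi : C -> C) (s : R) : R := RInt (modpow p phi s) 0 (2 * PI).

Definition mean_s (p : R) (phi : C -> C) (s : R) : R :=
  RInt (fun t => p * modpow p phi s t * Re (logder phi (polar s t))) 0 (2 * PI).

Lemma two_PI_pos : 0 < 2 * PI.
Proof. generalize PI_RGT_0; lra. Qed.

Lemma mean_derive (p : R) (phi : C -> C) (s : R) :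
  analytic phi -> nonvanishing phi -> s < 0 ->
  is_derive (mean p phi) s (mean_s p phi s).
Proof.
intros Ha H0 Hs; assert (HPI := two_PI_pos).
apply (is_derive_RInt_continuous_param (modpow p phi)
  (fun s t => p * modpow p phi s t * Re (logder phi (polar s t)))) with (r := - s); try lra.
- intros y t Hy _; apply Rabs_lt_between in Hy; split.
  + apply modpow_derive_s; trivial; lra.
  + apply continuous_slice, continuous_modpow; trivial; lra.
- intros t _; now apply continuous_modpow_s.
Qed.

(** The second derivative of the mean is the mean of the Laplacian, as the angular part
    [modpow_tt] integrates to 0 over a period. *)
Lemma mean_s_derive (p : R) (phi : C -> C) (s : R) :
  analytic phi -> nonvanishing phi -> s < 0 ->
  is_derive (mean_s p phi) s
    (RInt (fun t => p ^ 2 * modpow p phi s t * Cmod (logder phi (polar s t)) ^ 2) 0 (2 * PI)).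
Proof.
intros Ha H0 Hs; assert (HPI := two_PI_pos).
assert (D : is_derive (mean_s p phi) s (RInt (modpow_ss p phi s) 0 (2 * PI))).
{ apply (is_derive_RInt_continuous_param
    (fun s t => p * modpow p phi s t * Re (logder phi (polar s t)))
    (modpow_ss p phi)) with (r := - s); try lra.
  - intros y t Hy _; apply Rabs_lt_between in Hy; split.
    + apply modpow_derive_ss; trivial; lra.
    + apply (continuous_slice (fun s t => p * modpow p phi s t * Re (logder phi (polar s t)))).
      apply continuous_modpow_s; trivial; lra.
  - intros t _; now apply continuous_modpow_ss. }
assert (T : RInt (modpow_tt p phi s) 0 (2 * PI) = 0).
{ apply is_RInt_unique.
  replace 0 with (minus (p * modpow p phi s (2 * PI) * - Im (logder phi (polar s (2 * PI))))
     (p * modpow p phi s 0 * - Im (logder phi (polar s 0)))) at 2.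
  - apply (is_RInt_derive (V := R_CompleteNormedModule)
      (fun t => p * modpow p phi s t * - Im (logder phi (polar s t)))); intros t _.
    + now apply modpow_derive_tt.
    + now apply continuous_slice, continuous_modpow_tt.
  - unfold modpow; rewrite polar_2PI; apply Rminus_diag. }
replace (RInt _ 0 (2 * PI)) with (RInt (modpow_ss p phi s) 0 (2 * PI)); [exact D|].
assert (S : RInt (fun t => modpow_ss p phi s t + modpow_tt p phi s t) 0 (2 * PI) =
  RInt (modpow_ss p phi s) 0 (2 * PI) + RInt (modpow_tt p phi s) 0 (2 * PI)).
{ apply (RInt_plus (V := R_CompleteNormedModule)); (apply ex_RInt_slice; [lra|]);
    intros t _; [now apply continuous_modpow_ss|now apply continuous_modpow_tt]. }
rewrite T, Rplus_0_r in S; rewrite <- S.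
apply RInt_ext; intros t _; apply modpow_laplacian.
Qed.

Lemma exp_nondecreasing (x y : R) : x <= y -> exp x <= exp y.
Proof.
intros [H| ->]; [left; now apply exp_increasing|apply Rle_refl].
Qed.

(** * Growth of the means of [|phi|^p] *)

(** This is [sinh x >= x] at [x = - s], multiplied by [2 e^s]. *)
Lemma log_polar_density (s : R) : s <= 0 -> - (2 * s * exp s) <= 1 - exp s ^ 2.
Proof.
intros Hs.
assert (H := nonincreasing_of_derive (fun x => 1 - exp x ^ 2 + 2 * x * exp x)
  (fun x => 2 * exp x * (1 + x - exp x)) s 0 Hs).
assert (K : 1 - exp 0 ^ 2 + 2 * 0 * exp 0 <= 1 - exp s ^ 2 + 2 * s * exp s).
{ apply H.
  - intros t _; auto_derive; trivial; ring.
  - intros t _; generalize (exp_pos t) (exp_ineq1_le t); nra. }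
rewrite exp_0 in K; lra.
Qed.

Definition preschwarzian_le (lambda : R) (phi : C -> C) : Prop :=
  forall z, disk z -> (1 - Cmod z ^ 2) * Cmod (C_derive phi z / phi z) <= 2 * lambda.

Lemma logder_le (lambda : R) (phi : C -> C) (s t : R) :
  preschwarzian_le lambda phi -> s < 0 ->
  Cmod (logder phi (polar s t)) <= lambda / - s.
Proof.
intros HL Hs.
assert (Hd := disk_polar s t Hs); specialize (HL _ Hd).
unfold logder, Cdiv; rewrite <- Cmult_assoc, Cmod_mult.
fold (C_derive phi (polar s t) / phi (polar s t))%C.
rewrite Cmod_polar in *.
set (x := Cmod _) in *.
assert (Hx : 0 <= x) by apply Cmod_ge_0.
assert (Hw := log_polar_density s (Rlt_le _ _ Hs)).
apply (Rmult_le_reg_l (- s)); [lra|].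
replace (- s * (lambda / - s)) with lambda by (field; lra).
nra.
Qed.

Lemma mean_second_derivative_le (p lambda : R) (phi : C -> C) (s : R) :
  analytic phi -> nonvanishing phi -> preschwarzian_le lambda phi -> s < 0 ->
  RInt (fun t => p ^ 2 * modpow p phi s t * Cmod (logder phi (polar s t)) ^ 2) 0 (2 * PI)
   <= (p * lambda) ^ 2 / s ^ 2 * mean p phi s.
Proof.
intros Ha H0 HL Hs; assert (HPI := two_PI_pos).
unfold mean.
rewrite <- (RInt_scal (V := R_CompleteNormedModule) (modpow p phi s)).
2:{ apply ex_RInt_slice; [lra|]; intros t _; now apply continuous_modpow. }
apply RInt_le; [lra| | |].
- apply (ex_RInt_ext (fun t => modpow_ss p phi s t + modpow_tt p phi s t)).
  { intros t _; apply modpow_laplacian. }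
  apply (ex_RInt_plus (V := R_NormedModule)); (apply ex_RInt_slice; [lra|]);
    intros t _; [now apply continuous_modpow_ss|now apply continuous_modpow_tt].
- apply (ex_RInt_scal (V := R_NormedModule)).
  apply ex_RInt_slice; [lra|]; intros t _; now apply continuous_modpow.
- intros t _; change (scal ?x ?y) with (x * y).
  assert (Hu := modpow_pos p phi s t).
  assert (HQ := logder_le lambda phi s t HL Hs).
  assert (HQ2 : Cmod (logder phi (polar s t)) ^ 2 <= (lambda / - s) ^ 2).
  { apply pow_incr; split; [apply Cmod_ge_0|exact HQ]. }
  replace ((p * lambda) ^ 2 / s ^ 2 * modpow p phi s t) with
    (p ^ 2 * modpow p phi s t * (lambda / - s) ^ 2) by (field; lra).
  apply Rmult_le_compat_l; [|exact HQ2].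
  apply Rmult_le_pos; [apply pow2_ge_0|lra].
Qed.

Lemma Rpower_le_1 (x a : R) : 0 < x <= 1 -> 0 <= a -> Rpower x a <= 1.
Proof.
intros Hx Ha; unfold Rpower; rewrite <- exp_0; apply exp_nondecreasing.
assert (H : ln x <= 0) by (rewrite <- ln_1; apply ln_le; lra).
nra.
Qed.

Lemma Rpower_opp_m1 (a : R) : Rpower (- -1) a = 1.
Proof.
replace (- -1) with 1 by ring; unfold Rpower; rewrite ln_1, Rmult_0_r; apply exp_0.
Qed.

(** Comparison with [v = (-s)^-a], which satisfies [v'' = a (a + 1) s^-2 v].  The Wronskian
    [W = I' v - I v'] is nonincreasing, and [(I / v)' = W / v^2] is bounded because
    [1 / v <= 1] on [[-1, 0)]. *)
Lemma convex_growth (I I1 I2 : R -> R) (a : R) :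
  0 <= a ->
  (forall s, s < 0 -> is_derive I s (I1 s)) ->
  (forall s, s < 0 -> is_derive I1 s (I2 s)) ->
  (forall s, s < 0 -> I2 s <= a * (a + 1) / s ^ 2 * I s) ->
  exists K, forall s, -1 <= s < 0 -> I s * Rpower (- s) a <= K.
Proof.
intros Ha HI HI1 HI2.
set (W := fun s => (I1 s + a * I s / s) * Rpower (- s) (- a)).
assert (HW : forall s, -1 <= s < 0 -> W s <= W (-1)).
{ intros s Hs.
  apply (nonincreasing_of_derive W
    (fun s => (I2 s - a * (a + 1) / s ^ 2 * I s) * Rpower (- s) (- a)) (-1) s); [lra| |].
  - intros t Ht; unfold W, Rpower; auto_derive.
    + repeat split; try lra.
      * exists (I2 t); apply HI1; lra.
      * exists (I1 t); apply HI; lra.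
    + change (Derive (fun x => I x) t) with (Derive I t).
      rewrite (is_derive_unique _ _ _ (HI t ltac:(lra))).
      change (Derive (fun x => I1 x) t) with (Derive I1 t).
      rewrite (is_derive_unique _ _ _ (HI1 t ltac:(lra))).
      field; lra.
  - intros t Ht; specialize (HI2 t ltac:(lra)).
    assert (0 < Rpower (- t) (- a)) by apply exp_pos.
    nra. }
set (k := Rabs (W (-1))).
exists (I (-1) + k); intros s Hs.
assert (H := nonincreasing_of_derive (fun s => I s * Rpower (- s) a - k * s)
  (fun s => W s * (Rpower (- s) a * Rpower (- s) a) - k) (-1) s ltac:(lra)).
assert (H' : I s * Rpower (- s) a - k * s <= I (-1) * Rpower (- -1) a - k * -1).
{ apply H.
  - intros t Ht; unfold W, Rpower; auto_derive.
    + repeat split; try lra; exists (I1 t); apply HI; lra.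
    + change (Derive (fun x => I x) t) with (Derive I t).
      rewrite (is_derive_unique _ _ _ (HI t ltac:(lra))).
      replace (- a * ln (- t)) with (- (a * ln (- t))) by ring.
      rewrite exp_Ropp; field; split; [|lra].
      generalize (exp_pos (a * ln (- t))); lra.
  - intros t Ht.
    assert (H1 : 0 < Rpower (- t) a) by apply exp_pos.
    assert (H2 : Rpower (- t) a <= 1) by (apply Rpower_le_1; lra).
    assert (H3 : W t <= k) by (eapply Rle_trans; [apply HW; lra|apply Rle_abs]).
    assert (Hk : 0 <= k) by apply Rabs_pos.
    assert (H4 : 0 < Rpower (- t) a * Rpower (- t) a <= 1) by nra.
    nra. }
rewrite Rpower_opp_m1 in H'.
assert (Hk : 0 <= k) by apply Rabs_pos.
nra.
Qed.

(** The exponent [a] is the growth order of [phi] in the mean of order [p]. *)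
Lemma mean_growth (p lambda a : R) (phi : C -> C) :
  analytic phi -> nonvanishing phi -> preschwarzian_le lambda phi ->
  0 <= a -> a * (a + 1) = (p * lambda) ^ 2 ->
  exists K, forall s, -1 <= s < 0 -> mean p phi s * Rpower (- s) a <= K.
Proof.
intros Ha H0 HL Ha0 Ea.
apply (convex_growth (mean p phi) (mean_s p phi)
  (fun s => RInt (fun t => p ^ 2 * modpow p phi s t * Cmod (logder phi (polar s t)) ^ 2)
     0 (2 * PI))); [exact Ha0| | |].
- intros s Hs; now apply mean_derive.
- intros s Hs; now apply mean_s_derive.
- intros s Hs; rewrite Ea; now apply mean_second_derivative_le.
Qed.

(** * A maximal function for the radial growth *)

(** Up to a factor, [density] dominates the growth of [(-s)^c |phi|^p] along a radius, and
    [majorant] is its integral.  The integral starts at -2 although only [s >= -1] matters,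
    so that [majorant] is differentiable in a neighbourhood of -1 as well. *)
Definition density (p c : R) (phi : C -> C) (s t : R) : R :=
  Rpower (- s) (c - 1) * modpow p phi s t.

Definition majorant (p lambda c : R) (phi : C -> C) (s t : R) : R :=
  modpow p phi (-1) t + p * lambda * RInt (fun x => density p c phi x t) (-2) s.

Lemma continuous_density (p c : R) (phi : C -> C) (s t : R) :
  analytic phi -> nonvanishing phi -> s < 0 ->
  continuous (fun q : R * R => density p c phi (fst q) (snd q)) (s, t).
Proof.
intros Ha H0 Hs; apply continuous_Rmult; [|now apply continuous_modpow].
apply (continuous_comp fst (fun s => Rpower (- s) (c - 1))); [apply continuous_fst|].
apply (ex_derive_continuous (K := R_AbsRing) (V := R_NormedModule)).
unfold Rpower; auto_derive; simpl; lra.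
Qed.

Lemma majorant_derive (p lambda c : R) (phi : C -> C) (s t : R) :
  analytic phi -> nonvanishing phi -> s < 0 ->
  is_derive (fun s => majorant p lambda c phi s t) s (p * lambda * density p c phi s t).
Proof.
intros Ha H0 Hs; unfold majorant.
assert (Hc : forall x, x < 0 -> continuous (fun x => density p c phi x t) x).
{ intros x Hx; now apply (continuous_slice_l (density p c phi)), continuous_density. }
rewrite <- (Rplus_0_l (p * lambda * density p c phi s t)).
apply (is_derive_plus (K := R_AbsRing) (V := R_NormedModule) (fun _ => modpow p phi (-1) t)).
{ apply (is_derive_const (K := R_AbsRing) (V := R_NormedModule)). }
apply is_derive_scal.
apply (is_derive_RInt (V := R_NormedModule) (fun x => density p c phi x t)) with (a := -2);
  [|now apply Hc].
exists (mkposreal (- s) ltac:(lra)); intros y Hy.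
apply (RInt_correct (V := R_CompleteNormedModule)).
apply (ex_RInt_continuous (V := R_CompleteNormedModule)).
assert (y < 0) by (apply Rabs_lt_between in Hy; unfold minus, plus, opp in Hy; simpl in Hy; lra).
intros x Hx; apply Hc.
destruct Hx as [_ Hx]; unfold Rmax in Hx; destruct (Rle_dec _ _); lra.
Qed.

Lemma continuous_swap {V : UniformSpace} (F : R -> R -> V) (s t : R) :
  continuous (fun q : R * R => F (fst q) (snd q)) (s, t) ->
  continuous (fun q : R * R => F (snd q) (fst q)) (t, s).
Proof.
intros H.
apply (continuous_comp (fun q : R * R => (snd q, fst q))
  (fun q : R * R => F (fst q) (snd q))); [|exact H].
intros P [d Hd]; exists d; intros y [Hy1 Hy2]; apply Hd; split; assumption.
Qed.

Lemma continuous_majorant (p lambda c : R) (phi : C -> C) (s t : R) :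
  analytic phi -> nonvanishing phi -> -2 <= s < 0 ->
  continuous (majorant p lambda c phi s) t.
Proof.
intros Ha H0 Hs; unfold majorant.
apply (continuous_plus (V := R_NormedModule)).
{ apply continuous_slice, continuous_modpow; trivial; lra. }
apply (continuous_Rmult (fun _ => p * lambda)); [apply continuous_const|].
apply (ex_derive_continuous (K := R_AbsRing) (V := R_NormedModule)).
eexists.
apply (is_derive_RInt_continuous_param (fun t x => density p c phi x t)
  (fun t x => Rpower (- x) (c - 1) * (p * modpow p phi x t * - Im (logder phi (polar x t)))))
  with (r := - s); try lra.
- intros y x _ Hx; split.
  + apply is_derive_scal, modpow_derive_t; trivial; lra.
  + apply (continuous_slice_l (density p c phi)), continuous_density; trivial; lra.
- intros x Hx.
  apply (continuous_swap (fun x t =>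
    Rpower (- x) (c - 1) * (p * modpow p phi x t * - Im (logder phi (polar x t))))).
  apply continuous_Rmult; [|apply continuous_modpow_t; trivial; lra].
  apply (continuous_comp fst (fun s => Rpower (- s) (c - 1))); [apply continuous_fst|].
  apply (ex_derive_continuous (K := R_AbsRing) (V := R_NormedModule)).
  unfold Rpower; auto_derive; simpl; lra.
Qed.

Lemma majorant_increasing (p lambda c : R) (phi : C -> C) (s1 s2 t : R) :
  analytic phi -> nonvanishing phi -> 0 <= p * lambda -> s1 <= s2 < 0 ->
  majorant p lambda c phi s1 t <= majorant p lambda c phi s2 t.
Proof.
intros Ha H0 Hpl Hs.
apply Ropp_le_cancel.
apply (nonincreasing_of_derive (fun s => - majorant p lambda c phi s t)
  (fun s => - (p * lambda * density p c phi s t))); [lra| |].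
- intros x Hx; apply (is_derive_opp (V := R_NormedModule) (fun s => majorant p lambda c phi s t)).
  apply majorant_derive; trivial; lra.
- intros x Hx; rewrite <- Ropp_0; apply Ropp_le_contravar.
  apply Rmult_le_pos; [exact Hpl|].
  apply Rmult_le_pos; [left; apply exp_pos|left; apply modpow_pos].
Qed.

(** Since [(-s)^c] decreases, [(-s)^c |phi|^p] can only grow through [|phi|^p], at the rate
    [p u Re Q <= p lambda u / (-s)]. *)
Lemma modpow_le_majorant (p lambda c : R) (phi : C -> C) (s t : R) :
  analytic phi -> nonvanishing phi -> preschwarzian_le lambda phi ->
  0 < p -> 0 <= lambda -> 0 <= c -> -1 <= s < 0 ->
  Rpower (- s) c * modpow p phi s t <= majorant p lambda c phi s t.
Proof.
intros Ha H0 HL Hp Hl Hc Hs.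
assert (Hpl : 0 <= p * lambda) by (apply Rmult_le_pos; lra).
assert (H := nonincreasing_of_derive
  (fun s => Rpower (- s) c * modpow p phi s t - majorant p lambda c phi s t)
  (fun s => - (c * Rpower (- s) (c - 1)) * modpow p phi s t
     + Rpower (- s) c * (p * modpow p phi s t * Re (logder phi (polar s t)))
     - p * lambda * density p c phi s t) (-1) s ltac:(lra)).
assert (H' : Rpower (- s) c * modpow p phi s t - majorant p lambda c phi s t
  <= Rpower (- -1) c * modpow p phi (-1) t - majorant p lambda c phi (-1) t).
{ apply H; intros x Hx.
  - apply (is_derive_minus (K := R_AbsRing) (V := R_NormedModule)).
    2:{ apply majorant_derive; trivial; lra. }
    apply (is_derive_mult (K := R_AbsRing) (fun s => Rpower (- s) c) (fun s => modpow p phi s t)).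
    + unfold Rpower; auto_derive; [lra|].
      replace ((c - 1) * ln (- x)) with (c * ln (- x) + - ln (- x)) by ring.
      rewrite exp_plus, exp_Ropp, exp_ln by lra; field; lra.
    + apply modpow_derive_s; trivial; lra.
    + exact Rmult_comm.
  - assert (Hu := modpow_pos p phi x t).
    assert (Hr : 0 < Rpower (- x) (c - 1)) by apply exp_pos.
    assert (E : Rpower (- x) c = Rpower (- x) (c - 1) * - x).
    { rewrite <- (Rpower_1 (- x)) at 3 by lra; rewrite <- Rpower_plus; f_equal; ring. }
    assert (HQ : - x * Re (logder phi (polar x t)) <= lambda).
    { assert (K := logder_le lambda phi x t HL ltac:(lra)).
      assert (K2 := Rle_trans _ _ _ (Rle_abs _) (re_le_Cmod (logder phi (polar x t)))).
      replace lambda with (- x * (lambda / - x)) by (field; lra).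
      apply Rmult_le_compat_l; lra. }
    unfold density; rewrite E.
    set (v := Rpower (- x) (c - 1)) in *. set (u := modpow p phi x t) in *.
    assert (Hvu : 0 < v * u) by now apply Rmult_lt_0_compat.
    assert (Hcvu : 0 <= c * v * u) by (rewrite Rmult_assoc; apply Rmult_le_pos; lra).
    assert (HF : v * u * p * (- x * Re (logder phi (polar x t))) <= v * u * p * lambda).
    { apply Rmult_le_compat_l; [|exact HQ]. apply Rmult_le_pos; lra. }
    lra. }
assert (Hb := majorant_increasing p lambda c phi (-2) (-1) t Ha H0 Hpl ltac:(lra)).
unfold majorant in Hb at 1; rewrite RInt_point in Hb.
change (@zero R_CompleteNormedModule) with 0 in Hb.
rewrite Rpower_opp_m1 in H'.
replace (modpow p phi (-1) t + p * lambda * 0) with (modpow p phi (-1) t) in Hb by ring.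
lra.
Qed.

(** The mean of [density] is [(-s)^(c-1)] times the mean of [|phi|^p], hence
    [O((-s)^(c-1-a))], which is integrable up to 0 because [c > a]. *)
Lemma majorant_mean_bounded (p lambda a : R) (phi : C -> C) :
  analytic phi -> nonvanishing phi -> preschwarzian_le lambda phi ->
  0 < p -> 0 <= lambda -> 0 <= a < p -> a * (a + 1) = (p * lambda) ^ 2 ->
  exists M, forall s, -1 <= s < 0 ->
    RInt (majorant p lambda ((a + p) / 2) phi s) 0 (2 * PI) <= M.
Proof.
intros Ha H0 HL Hp Hl Hap Ea; assert (HPI := two_PI_pos).
assert (Hpl : 0 <= p * lambda) by (apply Rmult_le_pos; lra).
destruct (mean_growth p lambda a phi Ha H0 HL ltac:(lra) Ea) as [K HK].
set (c := (a + p) / 2). set (e := (p - a) / 2). assert (He : 0 < e) by (unfold e; lra).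
set (J := fun s => RInt (majorant p lambda c phi s) 0 (2 * PI)).
assert (HJ : forall s, -1 <= s < 0 -> is_derive J s
   (RInt (fun t => p * lambda * density p c phi s t) 0 (2 * PI))).
{ intros s Hs.
  apply (is_derive_RInt_continuous_param (majorant p lambda c phi)
    (fun s t => p * lambda * density p c phi s t)) with (r := Rmin (- s) 1); [lra| | |].
  - apply Rmin_pos; lra.
  - intros y t Hy _.
    assert (Hy1 := Rlt_le_trans _ _ _ Hy (Rmin_l _ _)).
    assert (Hy2 := Rlt_le_trans _ _ _ Hy (Rmin_r _ _)).
    apply Rabs_lt_between in Hy1; apply Rabs_lt_between in Hy2.
    split; [apply majorant_derive|apply continuous_majorant]; trivial; lra.
  - intros t _; apply (continuous_Rmult (fun _ => p * lambda)); [apply continuous_const|].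
    apply continuous_density; trivial; lra. }
assert (K0 : 0 <= K).
{ refine (Rle_trans _ _ _ _ (HK (-1) ltac:(lra))).
  apply Rmult_le_pos; [|left; apply exp_pos].
  apply RInt_ge_0; [lra| |].
  - apply ex_RInt_slice; [lra|]; intros t _; apply continuous_modpow; trivial; lra.
  - intros t _; left; apply modpow_pos. }
(* Here [c - 1 - a = e - 1], and [(-s)^(e-1)] has the primitive [- (-s)^e / e]. *)
exists (J (-1) + p * lambda * K / e); intros s Hs.
assert (H := nonincreasing_of_derive
  (fun s => J s + p * lambda * K / e * Rpower (- s) e)
  (fun s => RInt (fun t => p * lambda * density p c phi s t) 0 (2 * PI)
     - p * lambda * (K * Rpower (- s) (e - 1))) (-1) s ltac:(lra)).
assert (H' : J s + p * lambda * K / e * Rpower (- s) e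
   <= J (-1) + p * lambda * K / e * Rpower (- -1) e).
{ apply H; intros x Hx.
  - apply (is_derive_plus (K := R_AbsRing) (V := R_NormedModule)); [apply HJ; lra|].
    unfold Rpower; auto_derive; [lra|].
    replace ((e - 1) * ln (- x)) with (e * ln (- x) + - ln (- x)) by ring.
    rewrite exp_plus, exp_Ropp, exp_ln by lra; field; lra.
  - assert (E : RInt (fun t => p * lambda * density p c phi x t) 0 (2 * PI) =
      p * lambda * (Rpower (- x) (c - 1) * mean p phi x)).
    { rewrite <- Rmult_assoc; unfold mean.
      rewrite <- (RInt_scal (V := R_CompleteNormedModule) (modpow p phi x)).
      - apply RInt_ext; intros t _; unfold density; change (scal ?u ?v) with (u * v).
        match goal with |- @eq _ ?u ?v => change (@eq R u v) end; ring.
      - apply ex_RInt_slice; [lra|]; intros t _; apply continuous_modpow; trivial; lra. }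
    rewrite E.
    assert (HKx := HK x ltac:(lra)).
    assert (Es : Rpower (- x) (c - 1) = Rpower (- x) a * Rpower (- x) (e - 1)).
    { rewrite <- Rpower_plus; f_equal; unfold c, e; lra. }
    rewrite Es.
    assert (HR : 0 < Rpower (- x) (e - 1)) by apply exp_pos.
    assert (HF : Rpower (- x) a * Rpower (- x) (e - 1) * mean p phi x
       <= K * Rpower (- x) (e - 1)).
    { replace (Rpower (- x) a * Rpower (- x) (e - 1) * mean p phi x) with
       (mean p phi x * Rpower (- x) a * Rpower (- x) (e - 1)) by ring.
      apply Rmult_le_compat_r; lra. }
    apply (Rmult_le_compat_l _ _ _ Hpl) in HF; lra. }
rewrite Rpower_opp_m1 in H'.
assert (0 <= p * lambda * K / e * Rpower (- s) e).
{ apply Rmult_le_pos; [|left; apply exp_pos].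
  apply Rmult_le_pos; [|left; now apply Rinv_0_lt_compat].
  now apply Rmult_le_pos. }
fold (J s); lra.
Qed.

(** As [majorant] is nondecreasing in [s], its value at the end point [s] controls [phi] on
    the whole radius by [E^(1/p) (-x)^(-c/p)], and this is integrable up to 0. *)
Lemma radial_growth (p lambda c : R) (F : C -> C) (s t : R) :
  analytic F -> nonvanishing (C_derive F) -> preschwarzian_le lambda (C_derive F) ->
  0 < p -> 0 <= lambda -> 0 <= c < p -> -1 <= s < 0 ->
  Cmod (F (polar s t)) <= Cmod (F (polar (-1) t)) +
    Rpower (majorant p lambda c (C_derive F) s t) (/ p) * / (1 - c / p).
Proof.
intros HF H0 HL Hp Hl Hc Hs.
assert (Ha := analytic_C_derive F HF).
assert (Hpl : 0 <= p * lambda) by (apply Rmult_le_pos; lra).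
set (phi := C_derive F) in *.
set (E := majorant p lambda c phi s t).
assert (HE : 0 < E).
{ eapply Rlt_le_trans; [|apply modpow_le_majorant; trivial; lra].
  apply Rmult_lt_0_compat; [apply exp_pos|apply modpow_pos]. }
set (b := c / p).
assert (Hb : b < 1).
{ unfold b; apply (Rmult_lt_reg_r p); [lra|]. replace (c / p * p) with c by (field; lra); lra. }
set (m := Rpower E (/ p)).
assert (Hm : 0 < m) by apply exp_pos.
assert (Hphi : forall x, -1 <= x <= s -> Cmod (phi (polar x t)) <= m * Rpower (- x) (- b)).
{ intros x Hx.
  assert (Hd := disk_polar x t ltac:(lra)).
  assert (Hz : 0 < Cmod (phi (polar x t))) by now apply Cmod_gt_0, H0.
  assert (H1 : Rpower (- x) c * modpow p phi x t <= E).
  { eapply Rle_trans; [apply (modpow_le_majorant p lambda c); trivial; lra|].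
    apply majorant_increasing; trivial; lra. }
  assert (H2 : modpow p phi x t <= E * Rpower (- x) (- c)).
  { apply (Rmult_le_reg_l (Rpower (- x) c)); [apply exp_pos|].
    replace (Rpower (- x) c * (E * Rpower (- x) (- c))) with
      (E * (Rpower (- x) c * Rpower (- x) (- c))) by ring.
    rewrite <- Rpower_plus, Rplus_opp_r, Rpower_O by lra. lra. }
  replace (Cmod (phi (polar x t))) with (Rpower (modpow p phi x t) (/ p)).
  2:{ unfold modpow; rewrite Rpower_mult, Rinv_r by lra; now apply Rpower_1. }
  replace (m * Rpower (- x) (- b)) with (Rpower (E * Rpower (- x) (- c)) (/ p)).
  - apply Rle_Rpower_l; [left; now apply Rinv_0_lt_compat|].
    split; [apply modpow_pos|exact H2].
  - rewrite <- Rpower_mult_distr by (trivial; apply exp_pos).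
    unfold m; f_equal; rewrite Rpower_mult; f_equal; unfold b; field; lra. }
assert (Hinc := Cmod_increment_le (fun x => F (polar x t))
  (fun x => phi (polar x t) * polar x t)%C
  (fun x => - (m / (1 - b) * Rpower (- x) (1 - b)))
  (fun x => m * Rpower (- x) (- b)) (-1) s ltac:(lra)).
assert (Hinc' : Cmod (F (polar s t) - F (polar (-1) t)) <=
  - (m / (1 - b) * Rpower (- s) (1 - b)) - - (m / (1 - b) * Rpower (- -1) (1 - b))).
{ apply Hinc; intros x Hx.
  - apply (analytic_velocity F (fun x => polar x t)); [exact HF|apply disk_polar; lra|].
    apply is_velocity_polar_s.
  - unfold Rpower; auto_derive; [lra|].
    replace ((1 - b) * ln (- x)) with (ln (- x) + - b * ln (- x)) by ring.
    rewrite exp_plus, exp_ln by lra; field; lra.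
  - rewrite Cmod_mult, Cmod_polar.
    assert (exp x <= 1) by (rewrite <- exp_0; apply exp_nondecreasing; lra).
    generalize (Hphi x Hx) (Cmod_ge_0 (phi (polar x t))) (exp_pos x); nra. }
rewrite Rpower_opp_m1 in Hinc'.
assert (0 <= m / (1 - b) * Rpower (- s) (1 - b)).
{ apply Rmult_le_pos; [|left; apply exp_pos]. left; apply Rdiv_lt_0_compat; lra. }
generalize (Cmod_triangle_sub (F (polar s t)) (F (polar (-1) t))).
unfold Rdiv in *; lra.
Qed.

(** * Hardy spaces *)

Lemma rpow_pos (x p : R) : 0 < x -> rpow x p = Rpower x p.
Proof. intros Hx; unfold rpow; destruct (Rlt_dec 0 x); [reflexivity|lra]. Qed.

Lemma rpow_nonpos (x p : R) : x <= 0 -> rpow x p = 0.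
Proof. intros Hx; unfold rpow; destruct (Rlt_dec 0 x); [lra|reflexivity]. Qed.

Lemma rpow_ge_0 (x p : R) : 0 <= rpow x p.
Proof. unfold rpow; destruct (Rlt_dec 0 x); [left; apply exp_pos|apply Rle_refl]. Qed.

Lemma rpow_le (x y p : R) : 0 <= p -> x <= y -> rpow x p <= rpow y p.
Proof.
intros Hp Hxy; destruct (Rlt_dec 0 x) as [Hx|Hx].
- rewrite !rpow_pos by lra; apply Rle_Rpower_l; lra.
- rewrite rpow_nonpos by lra; apply rpow_ge_0.
Qed.

(** Valid for small [p] too: [x + y <= 2 max x y]. *)
Lemma rpow_plus_le (x y p : R) :
  0 <= p -> rpow (x + y) p <= Rpower 2 p * (rpow x p + rpow y p).
Proof.
intros Hp.
assert (H : forall z, rpow (2 * z) p = Rpower 2 p * rpow z p).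
{ intros z; destruct (Rlt_dec 0 z).
  - rewrite !rpow_pos by lra; now rewrite Rpower_mult_distr by lra.
  - rewrite !rpow_nonpos by lra; ring. }
assert (H2 : 0 < Rpower 2 p) by apply exp_pos.
assert (Hx := rpow_ge_0 x p). assert (Hy := rpow_ge_0 y p).
destruct (Rle_dec x y).
- apply Rle_trans with (rpow (2 * y) p); [apply rpow_le; lra|]. rewrite H.
  apply Rmult_le_compat_l; lra.
- apply Rle_trans with (rpow (2 * x) p); [apply rpow_le; lra|]. rewrite H.
  apply Rmult_le_compat_l; lra.
Qed.

Lemma continuous_rpow (p x : R) : 0 < p -> continuous (fun x => rpow x p) x.
Proof.
intros Hp; destruct (Rtotal_order x 0) as [Hx|[->|Hx]].
- apply (continuous_ext_loc _ (fun _ => 0)); [|apply continuous_const].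
  exists (mkposreal (- x) ltac:(lra)); intros y Hy; symmetry; apply rpow_nonpos.
  apply Rabs_lt_between in Hy; unfold minus, plus, opp in Hy; simpl in Hy; lra.
- apply (filterlim_locally (fun x => rpow x p)); intros eps.
  exists (mkposreal (Rpower eps (/ p)) (exp_pos _)); intros y Hy.
  change (Rabs (rpow y p - rpow 0 p) < eps).
  rewrite (rpow_nonpos 0), Rminus_0_r, Rabs_pos_eq by (apply rpow_ge_0 || lra).
  apply Rabs_lt_between in Hy; unfold minus, plus, opp in Hy; simpl in Hy.
  destruct (Rlt_dec 0 y).
  + rewrite rpow_pos by lra.
    replace (pos eps) with (Rpower (Rpower eps (/ p)) p).
    * apply Rlt_Rpower_l; lra.
    * rewrite Rpower_mult, Rinv_l by lra; apply Rpower_1, cond_pos.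
  + rewrite rpow_nonpos by lra; apply cond_pos.
- apply (continuous_ext_loc _ (fun x => Rpower x p)).
  + exists (mkposreal x Hx); intros y Hy; symmetry; apply rpow_pos.
    apply Rabs_lt_between in Hy; unfold minus, plus, opp in Hy; simpl in Hy; lra.
  + apply (ex_derive_continuous (K := R_AbsRing) (V := R_NormedModule)).
    unfold Rpower; auto_derive; exact Hx.
Qed.

Lemma ex_RInt_rpow_Cmod (c : R -> C) (p a b : R) :
  0 < p -> a <= b -> (forall t, a <= t <= b -> Ccontinuous c t) ->
  ex_RInt (fun t => rpow (Cmod (c t)) p) a b.
Proof.
intros Hp Hab Hc; apply (ex_RInt_continuous (V := R_CompleteNormedModule)).
rewrite Rmin_left, Rmax_right by exact Hab; intros t Ht.
apply (continuous_comp (fun t => Cmod (c t)) (fun x => rpow x p)); [|now apply continuous_rpow].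
apply (continuous_comp c Cmod); [now apply Hc|].
apply continuous_Cmod.
Qed.

Lemma polar_ln (r t : R) : 0 < r -> polar (ln r) t = (r * cis t)%C.
Proof. intros Hr; unfold polar; now rewrite exp_ln. Qed.

(** Circles of radius at most [e^-1] lie in a compact disk; on the others, [radial_growth]
    bounds [|F|^p] by an affine function of [majorant]. *)
Theorem hardy_of_preschwarzian (p lambda : R) (F : C -> C) :
  analytic F -> nonvanishing (C_derive F) -> preschwarzian_le lambda (C_derive F) ->
  0 <= lambda -> 0 < p -> p * (lambda ^ 2 - 1) < 1 ->
  exists M, forall r, 0 < r < 1 ->
    RInt (fun t => rpow (Cmod (F (r * cis t)%C)) p) 0 (2 * PI) <= M.
Proof.
intros HF H0 HL Hl Hp Hpl; assert (HPI := two_PI_pos).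
assert (Ha := analytic_C_derive F HF).
(* [a] is the nonnegative root of [a (a + 1) = (p lambda)^2]; then [a < p] amounts to
   [(p lambda)^2 < p (p + 1)]. *)
set (a := (sqrt (1 + 4 * (p * lambda) ^ 2) - 1) / 2).
assert (Hsq : 0 <= 4 * (p * lambda) ^ 2) by (generalize (pow2_ge_0 (p * lambda)); lra).
assert (Hs := sqrt_sqrt (1 + 4 * (p * lambda) ^ 2) ltac:(lra)).
assert (Ha0 : 0 <= a).
{ assert (1 <= sqrt (1 + 4 * (p * lambda) ^ 2)); [|unfold a; lra].
  rewrite <- sqrt_1 at 1; apply sqrt_le_1_alt; lra. }
assert (Hap : a < p).
{ assert (sqrt (1 + 4 * (p * lambda) ^ 2) < 2 * p + 1); [|unfold a; lra].
  rewrite <- (sqrt_pow2 (2 * p + 1)) by lra; apply sqrt_lt_1_alt.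
  split; [lra|]. nra. }
assert (Ea : a * (a + 1) = (p * lambda) ^ 2) by (unfold a; lra).
set (c := (a + p) / 2). assert (Hc : 0 <= c < p) by (unfold c; lra).
destruct (majorant_mean_bounded p lambda a (C_derive F)) as [M1 HM1]; trivial; try lra.
fold c in HM1.
destruct (analytic_bounded F (exp (-1)) HF) as [M0 HM0].
{ split; [left; apply exp_pos|rewrite <- exp_0; apply exp_increasing; lra]. }
set (D := rpow (/ (1 - c / p)) p).
assert (HD : 0 <= D) by apply rpow_ge_0.
set (k := Rpower 2 p). assert (Hk : 0 < k) by apply exp_pos.
exists (Rmax ((2 * PI) * rpow M0 p) (k * (2 * PI * rpow M0 p + D * M1))).
intros r Hr.
assert (HexF : ex_RInt (fun t => rpow (Cmod (F (r * cis t)%C)) p) 0 (2 * PI)).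
{ apply (ex_RInt_rpow_Cmod (fun t => F (r * cis t)%C)); [exact Hp|lra|].
  intros t _; apply Ccontinuous_analytic_circle; [exact HF|lra]. }
destruct (Rle_dec r (exp (-1))) as [Hre|Hre].
- refine (Rle_trans _ _ _ _ (Rmax_l _ _)).
  replace (2 * PI * rpow M0 p) with (RInt (fun _ : R => rpow M0 p) 0 (2 * PI)).
  2:{ rewrite RInt_const.
      exact (f_equal (fun x => x * rpow M0 p) (Rminus_0_r (2 * PI))). }
  apply RInt_le; [lra|exact HexF|apply ex_RInt_const|].
  intros t _; apply rpow_le; [lra|]; apply HM0.
  rewrite Cmod_mult, Cmod_cis, Cmod_R, Rabs_pos_eq; lra.
- refine (Rle_trans _ _ _ _ (Rmax_r _ _)).
  set (s := ln r).
  assert (Hls : -1 <= s < 0).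
  { split.
    - rewrite <- (ln_exp (-1)); left; apply ln_increasing; [apply exp_pos|lra].
    - rewrite <- ln_1; apply ln_increasing; lra. }
  set (E := majorant p lambda c (C_derive F) s).
  assert (HexE : ex_RInt E 0 (2 * PI)).
  { apply (ex_RInt_continuous (V := R_CompleteNormedModule)).
    intros t _; apply continuous_majorant; trivial; lra. }
  assert (HEpos : forall t, 0 < E t).
  { intros t; eapply Rlt_le_trans; [|apply modpow_le_majorant; trivial; lra].
    apply Rmult_lt_0_compat; [apply exp_pos|apply modpow_pos]. }
  apply Rle_trans with (RInt (fun t => k * (rpow M0 p + D * E t)) 0 (2 * PI)).
  + apply RInt_le; [lra|exact HexF| |].
    * apply (ex_RInt_scal (V := R_NormedModule)).
      apply (ex_RInt_plus (V := R_NormedModule)); [apply ex_RInt_const|].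
      now apply (ex_RInt_scal (V := R_NormedModule)).
    * intros t _.
      assert (H1 := radial_growth p lambda c F s t HF H0 HL Hp Hl Hc Hls).
      assert (H2 := HM0 (polar (-1) t) ltac:(rewrite Cmod_polar; lra)).
      assert (Hb : 0 < / (1 - c / p)).
      { apply Rinv_0_lt_compat.
        assert (c / p < 1); [|lra].
        apply (Rmult_lt_reg_r p); [lra|]. replace (c / p * p) with c by (field; lra); lra. }
      fold E in H1. unfold s in H1 at 1; rewrite polar_ln in H1 by lra.
      apply Rle_trans with (rpow (M0 + Rpower (E t) (/ p) * / (1 - c / p)) p).
      { apply rpow_le; [lra|]. change (majorant _ _ _ _ s t) with (E t) in H1; lra. }
      eapply Rle_trans; [apply rpow_plus_le; lra|].
      right; unfold k, D; f_equal; f_equal.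
      rewrite !rpow_pos; [|exact Hb|apply Rmult_lt_0_compat; [apply exp_pos|exact Hb]].
      rewrite <- Rpower_mult_distr by (trivial; apply exp_pos).
      rewrite Rpower_mult, Rinv_l, Rpower_1 by (trivial; lra). ring.
  + replace (RInt _ 0 (2 * PI)) with (k * (2 * PI * rpow M0 p + D * RInt E 0 (2 * PI))).
    * apply Rmult_le_compat_l; [lra|]. apply Rplus_le_compat_l.
      apply Rmult_le_compat_l; [exact HD|]. now apply HM1.
    * symmetry; apply is_RInt_unique.
      apply (is_RInt_scal (V := R_NormedModule)).
      apply (is_RInt_plus (V := R_NormedModule)).
      -- replace (2 * PI * rpow M0 p) with ((2 * PI - 0) * rpow M0 p) by ring.
         apply (is_RInt_const (V := R_NormedModule)).
      -- apply (is_RInt_scal (V := R_NormedModule)).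
         now apply (RInt_correct (V := R_CompleteNormedModule)).
Qed.

Lemma T_norm_le (h g : C -> C) (lambda : R) :
  Rbar_le (T_norm h g) (Finite (2 * lambda)) ->
  forall z theta, disk z -> 0 <= theta <= 2 * PI ->
    rotated_derivative h g theta z <> 0%C /\
    (1 - Cmod z ^ 2) * Cmod (rotated_derivative2 h g theta z /
                     rotated_derivative h g theta z)%C <= 2 * lambda.
Proof.
unfold T_norm; destruct (ClassicalEpsilon.excluded_middle_informative _) as [H|H].
{ intros K; now elim K. }
intros K z theta Hz Ht; split.
- intros E; apply H; exists z, theta; now repeat split.
- match type of K with Rbar_le (Lub_Rbar ?P) _ =>
    assert (HB := proj1 (Lub_Rbar_correct P)) end.
  exact (Rbar_le_trans (Finite _) _ (Finite _) (HB _ (ex_intro _ z (ex_intro _ theta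
    (conj Hz (conj Ht eq_refl))))) K).
Qed.

(** The rotation [k = e^{i theta}] stays explicit so that [F] can be used with [k = 1] and
    [k = -1] written as such. *)
Lemma rotation_hypotheses (h g : C -> C) (lambda theta : R) (k : C) :
  analytic h -> analytic g -> cis theta = k -> 0 <= theta <= 2 * PI ->
  Rbar_le (T_norm h g) (Finite (2 * lambda)) ->
  let F := fun z => (h z + k * g z)%C in
  analytic F /\ nonvanishing (C_derive F) /\ preschwarzian_le lambda (C_derive F).
Proof.
intros Hh Hg <- Htheta HT F.
assert (lin : forall u v z, analytic u -> analytic v -> disk z ->
  is_Cderive (fun z => u z + cis theta * v z)%C z (C_derive u z + cis theta * C_derive v z)%C).
{ intros u v z Hu Hv Hz.
  apply is_Cderive_plus; [now apply analytic_is_Cderive|].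
  replace (cis theta * C_derive v z)%C with (0 * v z + cis theta * C_derive v z)%C by ring.
  apply (is_Cderive_mult (fun _ => cis theta)); [apply is_Cderive_const|].
  now apply analytic_is_Cderive. }
assert (D1 : forall z, disk z -> C_derive F z = rotated_derivative h g theta z).
{ intros z Hz; apply is_C_derive_unique; now apply lin. }
assert (D2 : forall z, disk z -> C_derive (C_derive F) z = rotated_derivative2 h g theta z).
{ intros z Hz; apply is_C_derive_unique.
  apply (is_Cderive_local (rotated_derivative h g theta)) with (r := 1 - Cmod z).
  - unfold disk in Hz; lra.
  - intros w Hw; symmetry; apply D1; unfold disk.
    generalize (Cmod_triangle_sub w z); lra.
  - now apply lin; try apply analytic_C_derive. }
split; [|split].
- intros z Hz; eexists; now apply lin.
- intros z Hz; rewrite D1 by exact Hz; now apply T_norm_le with (lambda := lambda).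
- intros z Hz; rewrite D1, D2 by exact Hz; now apply T_norm_le.
Qed.

Theorem theorem4p2 (lambda : R) (hlambda : 1 <= lambda)
    (p : R) (hp : 0 < p) (hp_lt : Rbar_lt (Finite p) (hardy_exponent lambda))
    (f : C -> C) (hf : B_H lambda f) :
  h_space p f.
Proof.
assert (HPI := two_PI_pos).
destruct hf as (h & g & [[Hh [Hg Hf]] _] & HT).
split; [now exists h, g|].
assert (Hpl : p * (lambda ^ 2 - 1) < 1).
{ unfold hardy_exponent in hp_lt; destruct (Req_EM_T lambda 1) as [->|Hn]; [lra|].
  change (p < 1 / (lambda ^ 2 - 1)) in hp_lt.
  assert (0 < lambda ^ 2 - 1) by (simpl; nra).
  apply (Rmult_lt_compat_r (lambda ^ 2 - 1)) in hp_lt; [|assumption].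
  replace (1 / (lambda ^ 2 - 1) * (lambda ^ 2 - 1)) with 1 in hp_lt by (field; lra).
  exact hp_lt. }
(* Two rotations suffice, as [2 h = Fp + Fm] and [2 g = Fp - Fm]. *)
set (Fp := fun z => (h z + 1 * g z)%C). set (Fm := fun z => (h z + - (1) * g z)%C).
destruct (rotation_hypotheses h g lambda 0 1%C Hh Hg) as (P1 & P2 & P3); trivial; try lra.
{ unfold cis; now rewrite cos_0, sin_0. }
destruct (rotation_hypotheses h g lambda PI (- (1))%C Hh Hg) as (N1 & N2 & N3); trivial; try lra.
{ unfold cis; rewrite cos_PI, sin_PI; apply injective_projections; simpl; ring. }
destruct (hardy_of_preschwarzian p lambda Fp P1 P2 P3 ltac:(lra) hp Hpl) as [Mp HMp].
destruct (hardy_of_preschwarzian p lambda Fm N1 N2 N3 ltac:(lra) hp Hpl) as [Mm HMm].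
exists (rpow (/ (2 * PI) * (Rpower 2 p * (Mp + Mm))) (/ p)); intros r Hr.
specialize (HMp r Hr); specialize (HMm r Hr).
assert (Hd : forall t, disk (r * cis t)).
{ intros t; unfold disk; rewrite Cmod_mult, Cmod_cis, Cmod_R, Rabs_pos_eq; lra. }
apply rpow_le; [left; now apply Rinv_0_lt_compat|].
apply Rmult_le_compat_l; [left; now apply Rinv_0_lt_compat|].
assert (Cc : forall u t, analytic u -> Ccontinuous (fun t => u (r * cis t)%C) t).
{ intros u t Hu; apply Ccontinuous_analytic_circle; [exact Hu|lra]. }
assert (Ep : ex_RInt (fun t => rpow (Cmod (Fp (r * cis t)%C)) p) 0 (2 * PI)).
{ apply (ex_RInt_rpow_Cmod (fun t => Fp (r * cis t)%C)); [exact hp|lra|]; auto. }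
assert (Em : ex_RInt (fun t => rpow (Cmod (Fm (r * cis t)%C)) p) 0 (2 * PI)).
{ apply (ex_RInt_rpow_Cmod (fun t => Fm (r * cis t)%C)); [exact hp|lra|]; auto. }
apply Rle_trans with (RInt (fun t => Rpower 2 p *
  (rpow (Cmod (Fp (r * cis t)%C)) p + rpow (Cmod (Fm (r * cis t)%C)) p)) 0 (2 * PI)).
- apply RInt_le; [lra| | |].
  + apply ex_RInt_ext with
      (fun t => rpow (Cmod (h (r * cis t) + Cconj (g (r * cis t)))%C) p).
    { intros t _; now rewrite Hf. }
    apply (ex_RInt_rpow_Cmod (fun t => h (r * cis t) + Cconj (g (r * cis t)))%C);
      [exact hp|lra|].
    intros t _.
    destruct (proj1 (Ccontinuous_components _ _) (Cc h t Hh)) as [h1 h2].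
    destruct (proj1 (Ccontinuous_components _ _) (Cc g t Hg)) as [g1 g2].
    apply Ccontinuous_components; split.
    * now apply (continuous_plus (V := R_NormedModule) (fun t => Re (h (r * cis t)%C))
        (fun t => Re (g (r * cis t)%C))).
    * apply (continuous_plus (V := R_NormedModule) (fun t => Im (h (r * cis t)%C))
        (fun t => - Im (g (r * cis t)%C))); [exact h2|].
      now apply (continuous_opp (V := R_NormedModule) (fun t => Im (g (r * cis t)%C))).
  + apply (ex_RInt_scal (V := R_NormedModule)); now apply (ex_RInt_plus (V := R_NormedModule)).
  + intros t _; eapply Rle_trans; [|apply rpow_plus_le; lra].
    apply rpow_le; [lra|]; rewrite Hf by apply Hd.
    set (z := (r * cis t)%C).
    eapply Rle_trans; [apply Cmod_triangle|]; rewrite Cmod_conj.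
    assert (A1 := Cmod_triangle (Fp z) (Fm z)).
    assert (A2 := Cmod_triangle (Fp z) (- Fm z)).
    replace (Fp z + Fm z)%C with (2 * h z)%C in A1 by (unfold Fp, Fm; ring).
    replace (Fp z + - Fm z)%C with (2 * g z)%C in A2 by (unfold Fp, Fm; ring).
    rewrite Cmod_opp in A2; rewrite Cmod_mult, Cmod_R, Rabs_pos_eq in A1, A2 by lra.
    lra.
- rewrite (RInt_scal (V := R_CompleteNormedModule)
    (fun t => rpow (Cmod (Fp (r * cis t)%C)) p + rpow (Cmod (Fm (r * cis t)%C)) p)).
  2:{ now apply (ex_RInt_plus (V := R_NormedModule)). }
  apply Rmult_le_compat_l; [left; apply exp_pos|].
  rewrite (RInt_plus (V := R_CompleteNormedModule)) by assumption.
  now apply Rplus_le_compat.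
Qed.
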